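(* Let $k,n,m>0$ be positive integers. Then $$\sum_{p=0}^{n-k}(-1)^p\, q_p(q_m)\cdot D_k\, q_{n-p}(q_m)=\sum_{\substack{I,J\in\mathbb{Z}^m\\|I|+|J|=n}}(-1)^{(I+J)\cdot\delta-k}\,q_{(I+J)\cdot\delta-k}(A)\prod_{s=1}^m q_{i_s}(q_{m-s})\,q_{j_s}(q_{m-s}),$$ where $I=(i_1,\ldots,i_m)$, $J=(j_1,\ldots,j_m)$, $\delta=(1,2,\ldots,m)$, $(I+J)\cdot\delta$ is the usual dot product, and $|I|=i_1+\cdots+i_m$, $|J|=j_1+\cdots+j_m$. On the left-hand side, $D_k$ is applied to $q_{n-p}(q_m)$.
   Context: A strict partition is a finite weakly decreasing sequence of nonnegative integers $\lambda=(\lambda_1,\dots,\lambda_n)$ with no repeated nonzero parts. $\lambda\setminus\{\lambda_i\}:=(\lambda_1,\dots,\lambda_{i-1},\lambda_{i+1},\dots,\lambda_n)$. Let $A=\{a_1,a_2,\dots\}$ be an infinite alphabet of variables. Define $q_n=q_n(A)$ by $\kappa_z(A)=\prod_{a\in A}\frac{1+za}{1-za}=\sum_{n\in\mathbb{Z}}q_n(A)z^n$, so $q_0=1$ and $q_n=0$ for $n<0$. For $r,s\in\mathbb{Z}$ let $Q_{(r,s)}=q_rq_s+2\sum_{i=1}^s(-1)^iq_{r+i}q_{s-i}$. For $\lambda\in\mathbb{Z}^n$ with $n$ even, $Q_\lambda$ is the Pfaffian of the $n\times n$ skew-symmetric matrix whose $(i,j)$ entry is $Q_{(\lambda_i,\lambda_j)}$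 for $i<j$; if $n$ is odd, $\lambda$ is replaced by $(\lambda_1,\dots,\lambda_n,0)$. Let $\Gamma=\mathbb{Q}[q_1,q_2,\dots]$ be the ring generated by the $q_n$. The $Q_\lambda$ with $\lambda$ a strict partition form a basis of $\Gamma$ (with $Q_\emptyset=1$). Plethysm. For a formal sum of monomials $P=\sum_\mu c_\mu x^\mu$, define $q_n(P)$ by $\prod_\mu\left(\frac{1+zx^\mu}{1-zx^\mu}\right)^{c_\mu}=\sum_n q_n(P)z^n$ (so $q_n(P)=0$ for $n<0$). For $G\in\Gamma$, $q_n(G)$ means $q_n(P)$ with $P=G(A)$ regarded as a formal sum of monomials in $A$; in particular $q_n(q_0)=q_n(1)$. Omitting the alphabet means the alphabet is $A$. Operator $D_k$ ($k$ a positive integer): the linear operator on $\Gamma$ with, for $\lambda$ a strict partition, $D_k(Q_\lambda)=(-1)^{i+1}2Q_{\lambda\setminus\{\lambda_i\}}$ if $k=\lambda_i$ for some $i$, and $D_k(Q_\lambda)=0$ otherwise.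
   Formalization: The left-hand sum runs over p from 0 to n instead of 0 to n−k: the printed range fails, e.g. for n=1, k=m=2 the left side is empty while the right side is 4; for k=1 or m=1 the extra terms vanish. *)

(* Defs.v *)
From HB Require Import structures.
From mathcomp Require Import all_boot all_order all_fingroup all_algebra.
From mathcomp Require Import boolp classical_sets functions cardinality fsbigop.
From mathcomp Require Import mpoly.

Set Implicit Arguments.
Unset Strict Implicit.
Unset Printing Implicit Defensive.

Import GRing.Theory.
Local Open Scope ring_scope.

(* A function of the infinite alphabet a_1, a_2, ... is encoded, as in the
   inverse limit description of symmetric functions, by the sequence of its
   specializations F N at 0 = a_{N+1} = a_{N+2} = ...  Everything built below
   from the q_n is compatible with these specializations, so that the
   coefficient of a monomial in the infinite alphabet is the common value of
   its coefficients in the F N with N large enough.  The ring operations are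
   pointwise in N. *)
Definition symser : Type := forall N : nat, {mpoly rat[N]}.

HB.instance Definition _ := Choice.on symser.

Section SymserRing.
Implicit Types F G H : symser.

Let addA : associative (fun F G : symser => (fun N => F N + G N) : symser).
Proof. by move=> F G H; apply: functional_extensionality_dep => N; rewrite addrA. Qed.
Let addC : commutative (fun F G : symser => (fun N => F N + G N) : symser).
Proof. by move=> F G; apply: functional_extensionality_dep => N; rewrite addrC. Qed.
Let add0 : left_id ((fun N => 0) : symser)
  (fun F G : symser => (fun N => F N + G N) : symser).
Proof. by move=> F; apply: functional_extensionality_dep => N; rewrite add0r. Qed.
Let addN : left_inverse ((fun N => 0) : symser)
  (fun F : symser => (fun N => - F N) : symser)
  (fun F G : symser => (fun N => F N + G N) : symser).
Proof. by move=> F; apply: functional_extensionality_dep => N; rewrite addNr. Qed.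

HB.instance Definition _ := GRing.isZmodule.Build symser addA addC add0 addN.

Let mulA : associative (fun F G : symser => (fun N => F N * G N) : symser).
Proof. by move=> F G H; apply: functional_extensionality_dep => N; rewrite mulrA. Qed.
Let mulC : commutative (fun F G : symser => (fun N => F N * G N) : symser).
Proof. by move=> F G; apply: functional_extensionality_dep => N; rewrite mulrC. Qed.
Let mul1 : left_id ((fun N => 1) : symser)
  (fun F G : symser => (fun N => F N * G N) : symser).
Proof. by move=> F; apply: functional_extensionality_dep => N; rewrite mul1r. Qed.
Let mulD : left_distributive
  (fun F G : symser => (fun N => F N * G N) : symser) +%R.
Proof. by move=> F G H; apply: functional_extensionality_dep => N; rewrite mulrDl. Qed.
Let one_neq0 : ((fun N => 1) : symser) != 0.
Proof.
by apply/eqP => /(congr1 (fun F : symser => F 0)) /eqP; rewrite oner_eq0.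
Qed.

HB.instance Definition _ :=
  GRing.Zmodule_isComNzRing.Build symser mulA mulC mul1 mulD one_neq0.

Let scaleA (a b : rat) F :
  ((fun N => a *: (b *: F N)) : symser) = (fun N => (a * b) *: F N).
Proof. by apply: functional_extensionality_dep => N; rewrite scalerA. Qed.
Let scale1 : left_id (1 : rat)
  (fun (a : rat) F => (fun N => a *: F N) : symser).
Proof. by move=> F; apply: functional_extensionality_dep => N; rewrite scale1r. Qed.
Let scaleDr : right_distributive
  (fun (a : rat) F => (fun N => a *: F N) : symser) +%R.
Proof. by move=> a F G; apply: functional_extensionality_dep => N; rewrite scalerDr. Qed.
Let scaleDl F : {morph (fun a : rat => (fun N => a *: F N) : symser)
  : a b / a + b}.
Proof. by move=> a b; apply: functional_extensionality_dep => N; rewrite scalerDl. Qed.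

HB.instance Definition _ :=
  GRing.Zmodule_isLmodule.Build rat symser scaleA scale1 scaleDr scaleDl.

Let scaleAl (a : rat) F G : a *: (F * G) = a *: F * G.
Proof. by apply: functional_extensionality_dep => N; exact: scalerAl. Qed.

HB.instance Definition _ := GRing.Lmodule_isLalgebra.Build rat symser scaleAl.

Let scaleAr (a : rat) F G : a *: (F * G) = F * (a *: G).
Proof. by apply: functional_extensionality_dep => N; exact: scalerAr. Qed.

HB.instance Definition _ := GRing.Lalgebra_isAlgebra.Build rat symser scaleAr.

End SymserRing.

(* The coefficient of z^n of prod_a (1 + z a) / (1 - z a).  The variable 'X of
   {poly _} is z; truncating the geometric series 1 / (1 - z a) after z^n does
   not affect this coefficient. *)
Definition q (n : int) : symser := fun N =>
  if n is Posz d then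
    (\prod_(i < N) ((1 + ('X_i)%:P * 'X) * \poly_(j < d.+1) 'X_i ^+ j))`_d
  else 0.

(* c (c - 1) ... (c - j + 1) / j! *)
Definition gbin (c : rat) (j : nat) : rat :=
  (\prod_(i < j) (c - i%:R)) / (j`!)%:R.

(* ((1 + z x) / (1 - z x))^c = (1 + z x)^c (1 - z x)^(-c), both factors being
   expanded by the binomial series and truncated after z^d. *)
Definition kappa_pow (A : comAlgType rat) (d : nat) (c : rat) (x : A) : {poly A} :=
  (\poly_(j < d.+1) (gbin c j *: x ^+ j)) *
  (\poly_(j < d.+1) ((gbin (- c) j * (-1) ^+ j) *: x ^+ j)).

(* The plethysm q_n(P), the coefficient of z^n of
   prod_mu ((1 + z x^mu) / (1 - z x^mu))^(c_mu) for P = sum_mu c_mu x^mu.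
   A monomial mu that vanishes when a_{N+1} = a_{N+2} = ... = 0 contributes the
   factor 1, so the specialization at N only involves P N. *)
Definition qpl (n : int) (P : symser) : symser := fun N =>
  if n is Posz d then
    (\prod_(mu <- msupp (P N)) kappa_pow d (P N)@_mu 'X_[mu])`_d
  else 0.

Inductive Gamma : symser -> Prop :=
| Gamma_const (c : rat) : Gamma c%:A
| Gamma_q (n : nat) : Gamma (q n.+1)
| Gamma_add F G : Gamma F -> Gamma G -> Gamma (F + G)
| Gamma_mul F G : Gamma F -> Gamma G -> Gamma (F * G).

(* Since the upper bound s is an integer, the sum over 1 <= i <= s is indexed
   by nat; it is empty when s <= 0. *)
Definition Q2 (r s : int) : symser :=
  q r * q s +
  2%:R * \sum_(1 <= i < (if s is Posz s' then s'.+1 else 1%N))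
           (-1) ^+ i * (q (r + i%:Z) * q (s - i%:Z)).

Lemma even_ord_subproof (h : nat) (i : 'I_h) : (i.*2 < h.*2)%N.
Proof. by rewrite ltn_double. Qed.

Lemma odd_ord_subproof (h : nat) (i : 'I_h) : (i.*2.+1 < h.*2)%N.
Proof. by rewrite ltn_Sdouble. Qed.

(* pf A = 1 / (2^h h!) sum_s sgn(s) prod_(i < h) A_(s(2i), s(2i+1)), with rows
   and columns numbered from 0. *)
Definition pfaffian (R : comAlgType rat) (h : nat) (A : 'M[R]_(h.*2)) : R :=
  ((2 ^ h * h`!)%:R : rat)^-1 *:
  \sum_(s : 'S_(h.*2)) (-1) ^+ s *
     \prod_(i < h) A (s (Ordinal (even_ord_subproof i)))
                     (s (Ordinal (odd_ord_subproof i))).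

Definition Q_mx (l : seq int) (h : nat) : 'M[symser]_(h.*2) :=
  \matrix_(i, j)
    if (i < j)%N then Q2 (nth 0 l i) (nth 0 l j)
    else if (j < i)%N then - Q2 (nth 0 l j) (nth 0 l i)
    else 0.

Definition Q (lam : seq int) : symser :=
  let l := if odd (size lam) then rcons lam 0 else lam in
  pfaffian (Q_mx l (size l)./2).

(* Zero parts may be repeated. *)
Definition strict_partition (lam : seq nat) : bool :=
  sorted geq lam && uniq [seq x <- lam | x != 0%N].

Definition del_nth (T : Type) (i : nat) (s : seq T) : seq T :=
  take i s ++ drop i.+1 s.

Definition Qpart (lam : seq nat) : symser := Q [seq Posz x | x <- lam].

(* Here i is numbered from 0, so that the sign (-1)^(i+1) of the 1-based
   convention becomes (-1)^i. *)
Definition is_D (k : nat) (D : symser -> symser) : Prop :=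
  [/\ forall (c : rat) (F G : symser), Gamma F -> Gamma G ->
        D (c *: F + G) = c *: D F + D G,
      forall (lam : seq nat) (i : nat), strict_partition lam ->
        (i < size lam)%N -> nth 0%N lam i = k ->
        D (Qpart lam) = (-1) ^+ i * (2%:R * Qpart (del_nth i lam))
    & forall lam : seq nat, strict_partition lam -> k \notin lam ->
        D (Qpart lam) = 0].

(* As the Q_lam, lam strict, form a basis of Gamma, is_D k has a solution when
   k > 0, and any two solutions agree on Gamma; the values taken outside Gamma
   are irrelevant. *)
Definition D (k : nat) : symser -> symser :=
  xget ((fun=> 0) : symser -> symser) [set E | is_D k E]%classic.

(* Main.v *)
Require Import Defs.
From HB Require Import structures.
From mathcomp Require Import all_boot all_order all_fingroup all_algebra.
From mathcomp Require Import boolp classical_sets functions cardinality fsbigop.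
From mathcomp Require Import mpoly ring zify.

(** Why the identity holds.  Let [x] be a further variable.  On [Gamma],

      [D_k F = sum_j (-1)^j q_j(A) (coefficient of x^(k+j) in F(A, x))],

    that is, [D_k F] is the coefficient of [x^k] in [kappa_(-1/x)(A) F(A, x)].
    Granted this ([D_vertex]), the theorem is a computation with generating
    series.  Adjoining [x] gives [q_m(A, x) = q_m + 2 sum_s x^s q_(m-s)], and
    plethysm turns sums into products and the factor [x^s] into the
    substitution of [z x^s] for [z]; hence ([addvar_qpl_ser])

      [kappa_z(q_m(A, x)) = kappa_z(q_m) prod_s kappa_(z x^s)(q_(m-s))^2].

    The alternating sum over [p] multiplies this by [kappa_(-z)(q_m)], the
    inverse of the first factor ([gen_identity]).  In what remains, the
    coefficient of [z^n x^(k+e)] is the sum of the products of the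
    [q_(i_s)(q_(m-s)) q_(j_s)(q_(m-s))] with [|I| + |J| = n] and
    [(I+J).delta = k + e], and the formula for [D_k] multiplies it by
    [(-1)^e q_e] ([alt_sum_D]).

    The properties of plethysm come from Newton's recursion: [kappa_z(P)] is
    the only series [f] with constant term 1 and
    [z f' = 2 (sum of p_r z^r over odd r) f], where [p_r] is [P] with all
    variables raised to the power [r] ([newton_qpl], [newton_uniq]).  The
    recursion also shows that [q_n(q_m)] lies in [Gamma] ([Gamma_qpl_q]), where
    the conditions on [D_k] determine its values.

    The formula for [D_k] is proved with the vertex operators [phi r], where
    [phi r F] is the coefficient of [z^r] in [kappa_z(A) F(A, - 1 / z)]; the
    formula reads [D_k = (-1)^k phi (- k)].  The [phi r] anticommute up to
    scalars ([phi_anticomm]), and [Q_lam = phi lam_1 ... phi lam_n 1] ([QE]).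
    Indeed Pfaffians expand along their first row ([pfaffian_row]), and the
    words in the [phi r] satisfy the same expansion ([wick]): over the empty
    alphabet this follows from anticommutation, and it persists when variables
    are adjoined one at a time, because a new variable acts on every word by
    the same shifts of its letters ([xser_vac]).  Now [phi (- k)] can be moved
    through the word [Q_lam] to its right end, where it kills 1; on its way it
    meets at most one letter [k], which it removes ([is_D_vertex]).  Finally
    the [Q_lam] span [Gamma] ([Gamma_Qspan]), so that every operator satisfying
    the conditions on [D_k] agrees there with [(-1)^k phi (- k)]. *)

Set Implicit Arguments.
Unset Strict Implicit.
Unset Printing Implicit Defensive.

Import Order.TTheory GRing.Theory.
Local Open Scope ring_scope.

(** * Formal power series *)

(** A record, so that [*] is the convolution and never the pointwise product of
    functions. *)
Record fps (R : Type) := Fps { cf : nat -> R }.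

HB.instance Definition _ (R : Type) := gen_eqMixin (fps R).
HB.instance Definition _ (R : Type) := gen_choiceMixin (fps R).

Lemma fpsP (R : Type) (f g : fps R) : (forall n, cf f n = cf g n) <-> f = g.
Proof.
split=> [|-> //]; case: f g => [f] [g] /= fg; congr Fps.
exact: functional_extensionality_dep.
Qed.

Section FpsRing.
Variable R : comNzRingType.
Implicit Types f g h : fps R.

Definition fps_mul f g := Fps (fun n => \sum_(i < n.+1) cf f i * cf g (n - i)).
Definition fps_one : fps R := Fps (fun n => (n == 0%N)%:R).

Definition truncp (d : nat) f : {poly R} := \poly_(i < d) cf f i.

Lemma coef_truncM d n f g : (n < d)%N ->
  (truncp d f * truncp d g)`_n = cf (fps_mul f g) n.
Proof.
move=> nd; rewrite coefM; apply: eq_bigr => i _.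
by rewrite !coef_poly !ifT //; have := ltn_ord i; lia.
Qed.

Let addA : associative (fun f g => Fps (fun n => cf f n + cf g n)).
Proof. by move=> f g h; apply/fpsP => n /=; rewrite addrA. Qed.
Let addC : commutative (fun f g => Fps (fun n => cf f n + cf g n)).
Proof. by move=> f g; apply/fpsP => n /=; rewrite addrC. Qed.
Let add0 : left_id (Fps (fun=> 0)) (fun f g => Fps (fun n => cf f n + cf g n)).
Proof. by move=> f; apply/fpsP => n /=; rewrite add0r. Qed.
Let addN : left_inverse (Fps (fun=> 0)) (fun f => Fps (fun n => - cf f n))
  (fun f g => Fps (fun n => cf f n + cf g n)).
Proof. by move=> f; apply/fpsP => n /=; rewrite addNr. Qed.

HB.instance Definition _ := GRing.isZmodule.Build (fps R) addA addC add0 addN.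

Let mulA : associative fps_mul.
Proof.
move=> f g h; apply/fpsP => n.
rewrite -(coef_truncM _ _ (ltnSn n)) -[RHS](coef_truncM _ _ (ltnSn n)).
transitivity ((truncp n.+1 f * truncp n.+1 g * truncp n.+1 h)`_n).
  rewrite -mulrA !coefM; apply: eq_bigr => i _; congr (_ * _).
  by rewrite coef_poly ltnS leq_subr -(coef_truncM _ _ (d := n.+1)) // ltnS leq_subr.
rewrite !coefM; apply: eq_bigr => i _; congr (_ * _).
by rewrite [RHS]coef_poly ltn_ord -(coef_truncM _ _ (d := n.+1)).
Qed.
Let mulC : commutative fps_mul.
Proof.
by move=> f g; apply/fpsP => n; rewrite -!(coef_truncM _ _ (ltnSn n)) mulrC.
Qed.
Let mul1 : left_id fps_one fps_mul.
Proof.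
move=> f; apply/fpsP => n /=; rewrite big_ord_recl /= mul1r subn0 big1 ?addr0 //.
by move=> i _; rewrite mul0r.
Qed.
Let mulD : left_distributive fps_mul +%R.
Proof.
move=> f g h; apply/fpsP => n /=; rewrite -big_split /=.
by apply: eq_bigr => i _; rewrite mulrDl.
Qed.
Let one_neq0 : fps_one != 0.
Proof.
by apply/eqP => /fpsP /(_ 0%N) /= /eqP; rewrite oner_eq0.
Qed.
HB.instance Definition _ :=
  GRing.Zmodule_isComNzRing.Build (fps R) mulA mulC mul1 mulD one_neq0.

Lemma cfD f g n : cf (f + g) n = cf f n + cf g n. Proof. by []. Qed.
Lemma cfN f n : cf (- f) n = - cf f n. Proof. by []. Qed.
Lemma cf0 n : cf (0 : fps R) n = 0. Proof. by []. Qed.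
Lemma cf1 n : cf (1 : fps R) n = (n == 0%N)%:R. Proof. by []. Qed.
Lemma cfM f g n : cf (f * g) n = \sum_(i < n.+1) cf f i * cf g (n - i).
Proof. by []. Qed.
Lemma cf_sum I (r : seq I) P (F : I -> fps R) n :
  cf (\sum_(i <- r | P i) F i) n = \sum_(i <- r | P i) cf (F i) n.
Proof. by rewrite (big_morph (fun f => cf f n) (fun f g => cfD f g n) (cf0 n)). Qed.

Lemma cf_trunc d f n : (n < d)%N -> (truncp d f)`_n = cf f n.
Proof. by move=> nd; rewrite coef_poly nd. Qed.

(** Lets power series replace the truncated polynomials that define the [q_n]
    and their plethysms. *)
Lemma cf_prod_poly I (r : seq I) (F : I -> fps R) (P : I -> {poly R}) d n :
    (n <= d)%N ->
    (forall i j, (j <= d)%N -> (P i)`_j = cf (F i) j) ->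
  (\prod_(i <- r) P i)`_n = cf (\prod_(i <- r) F i) n.
Proof.
move=> nd PF; elim: r n nd => [|i r IH] n nd; first by rewrite !big_nil coef1.
rewrite !big_cons coefM cfM; apply: eq_bigr => j _.
by rewrite PF ?IH //; have := ltn_ord j; lia.
Qed.

Lemma cf_prod_fin (U : finType) (F : U -> fps R) n :
  cf (\prod_u F u) n =
  \sum_(I : {ffun U -> 'I_n.+1} | (\sum_u I u == n)%N) \prod_u cf (F u) (I u).
Proof.
rewrite -(@cf_prod_poly _ _ F (fun s => truncp n.+1 (F s)) n n) //; last first.
  by move=> i j jn; rewrite cf_trunc.
under eq_bigr do rewrite /truncp poly_def.
rewrite bigA_distr_bigA /= coef_sum [RHS]big_mkcond; apply: eq_bigr => I _.
rewrite scaler_prod coefZ prodrXr coefXn eq_sym.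
by case: eqP => _; rewrite (mulr1, mulr0).
Qed.

(** The series [(1 + zx) / (1 - zx)].  Its coefficients [1], [2x], [2x^2], ...
    are the source of all the factors [(a != 0).+1] below. *)
Definition kap1 (x : R) : fps R := Fps (fun a => x ^+ a *+ (a != 0%N).+1).

Definition fpsX (c : R) : fps R := Fps (fun n => c *+ (n == 1%N)).
Definition geom (x : R) : fps R := Fps (fun n => x ^+ n).

Lemma cfXM c f n :
  cf (fpsX c * f) n = if n is n'.+1 then c * cf f n' else 0.
Proof.
rewrite cfM; case: n => [|n].
  by rewrite big_ord1 /= mulr0n mul0r.
rewrite big_ord_recl /= mulr0n mul0r add0r big_ord_recl /= mulr1n subSS subn0.
by rewrite big1 ?addr0 // => i _; rewrite mulr0n mul0r.
Qed.

Lemma geomE x : (1 - fpsX x) * geom x = 1.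
Proof.
apply/fpsP => -[|n]; rewrite mulrBl mul1r cfD cfN cfXM cf1 /= ?subr0 ?expr0 //.
by rewrite exprS subrr.
Qed.

Lemma kap1E x : kap1 x = (1 + fpsX x) * geom x.
Proof.
apply/fpsP => -[|n]; rewrite mulrDl mul1r cfD cfXM /= ?addr0 ?expr0 //.
by rewrite exprS mulr2n.
Qed.

Lemma fpsXN x : fpsX (- x) = - fpsX x.
Proof. by apply/fpsP => n; rewrite cfN /= mulNrn. Qed.

Lemma kap1N x : kap1 x * kap1 (- x) = 1.
Proof.
transitivity ((1 - fpsX x) * geom x * ((1 - fpsX (- x)) * geom (- x))).
  by rewrite !kap1E fpsXN opprK mulrACA (mulrC (1 + _)) mulrACA.
by rewrite !geomE mulr1.
Qed.

(** The Euler operator [z d/dz], a derivation. *)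
Definition theta f : fps R := Fps (fun n => cf f n *+ n).

Lemma thetaM f g : theta (f * g) = theta f * g + f * theta g.
Proof.
apply/fpsP => n; rewrite cfD [LHS]/= !cfM -sumrMnl -big_split /=.
apply: eq_bigr => i _; rewrite mulrnAl mulrnAr -mulrnDr.
by congr (_ *+ _); have := ltn_ord i; lia.
Qed.

(** Substitution of [y z] for [z]. *)
Definition zscale (y : R) f : fps R := Fps (fun n => y ^+ n * cf f n).

Lemma zscale1 y : zscale y 1 = 1.
Proof. by apply/fpsP => -[|n]; rewrite [LHS]/= cf1 /= ?mulr1 ?expr0 ?mulr0. Qed.

Lemma zscaleM y f g : zscale y (f * g) = zscale y f * zscale y g.
Proof.
apply/fpsP => n; rewrite [LHS]/= !cfM mulr_sumr; apply: eq_bigr => i _ /=.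
rewrite mulrACA -exprD; congr (_ ^+ _ * _); have := ltn_ord i; lia.
Qed.

Lemma zscale_kap1 y x : zscale y (kap1 x) = kap1 (y * x).
Proof. by apply/fpsP => n /=; rewrite mulrnAr exprMn_comm //; apply: mulrC. Qed.

End FpsRing.

Definition fmap_fps (R S : Type) (h : R -> S) (f : fps R) : fps S :=
  Fps (fun n => h (cf f n)).

Section FpsMap.
Variables (R S : comNzRingType) (h : {rmorphism R -> S}).

Lemma fmap1 : fmap_fps h 1 = 1.
Proof. by apply/fpsP => n; rewrite [LHS]/= !cf1 rmorph_nat. Qed.

Lemma fmapM : {morph fmap_fps h : f g / f * g}.
Proof.
move=> f g; apply/fpsP => n; rewrite [LHS]/= cfM rmorph_sum.
by apply: eq_bigr => i _; rewrite rmorphM.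
Qed.

Lemma fmap_prod I (r : seq I) P (F : I -> fps R) :
  fmap_fps h (\prod_(i <- r | P i) F i) = \prod_(i <- r | P i) fmap_fps h (F i).
Proof. exact: (big_morph _ fmapM fmap1). Qed.

Lemma fmap_kap1 x : fmap_fps h (kap1 x) = kap1 (h x).
Proof. by apply/fpsP => n /=; rewrite rmorphMn rmorphXn. Qed.

End FpsMap.

Lemma fmap_prod_kap1 (R S : comNzRingType) (h : {rmorphism R -> S})
    I (r : seq I) (F : I -> R) :
  fmap_fps h (\prod_(i <- r) kap1 (F i)) = \prod_(i <- r) kap1 (h (F i)).
Proof. by rewrite fmap_prod; apply: eq_bigr => i _; apply: fmap_kap1. Qed.

(** * Adjoining a variable to the alphabet *)

Section Evaluation.
Variable N : nat.
Lemma evD (F G : symser) : (F + G) N = F N + G N. Proof. by []. Qed.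
Lemma evN (F : symser) : (- F) N = - F N. Proof. by []. Qed.
Lemma evM (F G : symser) : (F * G) N = F N * G N. Proof. by []. Qed.
Lemma evZ c (F : symser) : (c *: F) N = c *: F N. Proof. by []. Qed.
Lemma ev0 : (0 : symser) N = 0. Proof. by []. Qed.
Lemma ev1 : (1 : symser) N = 1. Proof. by []. Qed.
Lemma ev_sum I (r : seq I) P (F : I -> symser) :
  (\sum_(i <- r | P i) F i) N = \sum_(i <- r | P i) F i N.
Proof. by rewrite (big_morph (fun F : symser => F N) evD ev0). Qed.
Lemma ev_prod I (r : seq I) P (F : I -> symser) :
  (\prod_(i <- r | P i) F i) N = \prod_(i <- r | P i) F i N.
Proof. by rewrite (big_morph (fun F : symser => F N) evM ev1). Qed.
Lemma evX (F : symser) k : (F ^+ k) N = F N ^+ k.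
Proof. by elim: k => // k IH; rewrite !exprS evM IH. Qed.
Lemma evMn (F : symser) k : (F *+ k) N = F N *+ k.
Proof. by elim: k => // k IH; rewrite !mulrS evD IH. Qed.
Lemma ev_sign k (F : symser) : ((-1) ^+ k * F) N = (-1) ^+ k * F N.
Proof. by rewrite evM evX evN ev1. Qed.
End Evaluation.

Lemma symserP (F G : symser) : (forall N, F N = G N) -> F = G.
Proof. exact: functional_extensionality_dep. Qed.

Section MuniVariables.
Variables (n : nat) (R : nzRingType).

Lemma muni_widen (i : 'I_n) :
  muni ('X_(widen_ord (leqnSn n) i) : {mpoly R[n.+1]}) = ('X_i)%:P.
Proof.
rewrite muniE msuppX big_seq1 mcoeffX eqxx scale1r mnmE.
rewrite (_ : (_ == _) = false) ?expr0 ?alg_polyC; last first.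
  by apply/eqP => /(congr1 val) /=; have := ltn_ord i; lia.
by congr ('X_[_])%:P; apply/mnmP => j; rewrite !mnmE; congr nat_of_bool.
Qed.

Lemma muni_last : muni ('X_ord_max : {mpoly R[n.+1]}) = 'X.
Proof.
rewrite muniE msuppX big_seq1 mcoeffX eqxx scale1r mnmE eqxx expr1.
rewrite (_ : [multinom _ | i < n] = 0%MM) ?mpolyX0 ?scale1r //.
apply/mnmP => j; rewrite !mnmE -!val_eqE /=.
by have := ltn_ord j; case: eqP => //; lia.
Qed.

End MuniVariables.

Lemma mcoeff_muni n (R : nzRingType) (p : {mpoly R[n.+1]}) (m : 'X_{1..n.+1}) :
  (muni p)`_(m ord_max) @_[multinom m (widen_ord (leqnSn n) i) | i < n] = p@_m.
Proof.
rewrite muniE coef_sum raddf_sum /= [in RHS](mpolyE p) raddf_sum /=.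
apply: eq_bigr => m' _; rewrite coefZ coefXn mulr_natr [RHS]mcoeffZ mcoeffX.
rewrite mcoeffMn mcoeffZ mcoeffX -mulrnAr -mulrnA mulnb.
congr (_ * _%:R); congr nat_of_bool;
apply/andP/eqP => [[/eqP E /eqP L]|->] //.
apply/mnmP => i; case: (unliftP ord_max i) => [j ->|->] //.
have -> : lift ord_max j = widen_ord (leqnSn n) j.
  by apply: val_inj; rewrite /= /bump leqNgt ltn_ord.
by move/mnmP: E => /(_ j); rewrite !mnmE.
Qed.

Lemma muni_inj n (R : nzRingType) : injective (@muni n R).
Proof. by move=> p p' pp'; apply/mpolyP => m; rewrite -!mcoeff_muni pp'. Qed.

(** [p(A, x)] as a polynomial in [x], the last of the variables. *)
Definition addvar N (p : {mpoly rat[N.+1]}) : {poly {mpoly rat[N]}} := muni p.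

Section Addvar.
Variable N : nat.

Fact addvar_additive : zmod_morphism (@addvar N).
Proof. by move=> p p'; rewrite /addvar muniB. Qed.
Fact addvar_mult : monoid_morphism (@addvar N).
Proof. by split=> [|p p']; rewrite /addvar ?muni1 ?muniM. Qed.
HB.instance Definition _ :=
  GRing.isZmodMorphism.Build _ _ (@addvar N) addvar_additive.
HB.instance Definition _ :=
  GRing.isMonoidMorphism.Build _ _ (@addvar N) addvar_mult.

Lemma addvar_widen (i : 'I_N) :
  addvar 'X_(widen_ord (leqnSn N) i) = ('X_i)%:P.
Proof. exact: muni_widen. Qed.

Lemma addvar_last : @addvar N 'X_ord_max = 'X.
Proof. exact: muni_last. Qed.

Lemma addvarZ c (p : {mpoly rat[N.+1]}) : addvar (c *: p) = c%:MP *: addvar p.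
Proof. exact: muniZ. Qed.

Lemma addvar_inj : injective (@addvar N).
Proof. exact: muni_inj. Qed.

End Addvar.

Definition kappaN N : fps {mpoly rat[N]} := \prod_(i < N) kap1 'X_i.

Lemma qE (n : nat) N : q n N = cf (kappaN N) n.
Proof.
apply: (@cf_prod_poly _ _ _ _ _ n) => // i j jn.
rewrite mulrDl mul1r coefD -mulrA coefCM coefXM !coef_poly ltnS jn.
case: j jn => [|j] jn //=; first by rewrite mulr0 addr0 expr0.
by rewrite ltnS (ltnW jn) -exprS mulr2n.
Qed.

Lemma addvar_kappaN N : fmap_fps (@addvar N) (kappaN N.+1) =
  fmap_fps (@polyC _) (kappaN N) * kap1 'X.
Proof.
transitivity (\prod_(i < N.+1) kap1 (addvar 'X_i)); first exact: fmap_prod_kap1.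
rewrite big_ord_recr /= addvar_last; congr (_ * _).
transitivity (\prod_(i < N) kap1 (('X_i)%:P : {poly {mpoly rat[N]}})).
  by apply: eq_bigr => i _; rewrite addvar_widen.
by symmetry; exact: fmap_prod_kap1.
Qed.

(** The coefficient of [x^j] in [F(A, x)], where [x] is one more variable.
    Locked, so that unification does not unfold it into the arithmetic of
    multivariate polynomials. *)
HB.lock Definition xcoef (j : nat) (F : symser) : symser := fun N => (addvar (F N.+1))`_j.

Lemma xcoefE j F N : xcoef j F N = (addvar (F N.+1))`_j.
Proof. by rewrite xcoef.unlock. Qed.

Lemma xcoef_lin j c F G : xcoef j (c *: F + G) = c *: xcoef j F + xcoef j G.
Proof.
apply: symserP => N; rewrite !(evD, evZ) !xcoefE !(evD, evZ) /= raddfD /= coefD; congr (_ + _).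
by rewrite addvarZ coefZ mul_mpolyC.
Qed.

Lemma xcoef_D j F G : xcoef j (F + G) = xcoef j F + xcoef j G.
Proof. by rewrite -{1}(scale1r F) xcoef_lin scale1r. Qed.
Lemma xcoef_0 j : xcoef j 0 = 0.
Proof. by apply: symserP => N; rewrite xcoefE !ev0 raddf0 coef0. Qed.
Lemma xcoef_Z j c F : xcoef j (c *: F) = c *: xcoef j F.
Proof. by rewrite -(addr0 (c *: F)) xcoef_lin xcoef_0 addr0. Qed.
Lemma xcoef_sum j I (r : seq I) P (F : I -> symser) :
  xcoef j (\sum_(i <- r | P i) F i) = \sum_(i <- r | P i) xcoef j (F i).
Proof. by rewrite (big_morph (xcoef j) (xcoef_D j) (xcoef_0 j)). Qed.

Lemma xcoef_M j F G : xcoef j (F * G) = \sum_(i < j.+1) xcoef i F * xcoef (j - i) G.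
Proof.
apply: symserP => N; rewrite ev_sum xcoefE evM rmorphM /= coefM.
by apply: eq_bigr => i _; rewrite evM !xcoefE.
Qed.

Lemma xcoef_const j c : xcoef j c%:A = c%:A *+ (j == 0%N).
Proof.
apply: symserP => N; rewrite evMn xcoefE !evZ !ev1 addvarZ rmorph1 alg_polyC coefC.
by case: (j == 0%N); rewrite ?mulr1n ?mulr0n // -alg_mpolyC.
Qed.

Lemma xcoef_1 j : xcoef j 1 = (j == 0%N)%:R.
Proof. by rewrite -[X in xcoef j X]scale1r xcoef_const scale1r. Qed.

Lemma xcoef_sign j k F : xcoef j ((-1) ^+ k * F) = (-1) ^+ k * xcoef j F.
Proof. by rewrite -signr_odd; case: odd; rewrite ?mul1r // !mulN1r -!scaleN1r xcoef_Z. Qed.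

Lemma q_neg (r : int) : (r < 0)%R -> q r = 0.
Proof. by case: r. Qed.

Lemma q0 : q 0 = 1.
Proof.
apply: symserP => N; rewrite (qE 0%N) /kappaN.
have H I (s : seq I) (F : I -> {mpoly rat[N]}) :
    cf (\prod_(i <- s) kap1 (F i)) 0%N = 1.
  elim: s => [|i s IH]; rewrite ?big_nil // big_cons cfM big_ord1 IH /=.
  by rewrite expr0 mulr1.
exact: H.
Qed.

(** Coefficientwise, [kappa_z(A, x) = kappa_z(A) (1 + zx) / (1 - zx)]. *)
Lemma xcoef_q (a : nat) (r : int) : xcoef a (q r) = q (r - a%:Z) *+ (a != 0%N).+1.
Proof.
case: r => [n|n]; last first.
  rewrite (_ : q (Negz n) = 0) // xcoef_0 (_ : q _ = 0) ?mul0rn //.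
  by apply: q_neg; lia.
apply: symserP => N; rewrite evMn xcoefE qE.
have /fpsP/(_ n) := addvar_kappaN N; rewrite /= => ->; rewrite coef_sum.
under eq_bigr do rewrite mulrnAr coefMn coefCM coefXn.
case: (leqP a n) => an.
  have Hn : (n - a < n.+1)%N by lia.
  rewrite (bigD1 (Ordinal Hn)) //= subKn // eqxx mulr1 big1 ?addr0.
    by rewrite subzn // qE.
  move=> i /eqP ni; rewrite (_ : (a == _) = false) ?mulr0 ?mul0rn //.
  by apply/eqP => E; apply: ni; apply: val_inj => /=; have := ltn_ord i; lia.
rewrite big1 => [|i _].
  by rewrite q_neg ?mul0rn //; lia.
rewrite (_ : (a == _) = false) ?mulr0 ?mul0rn //.
by apply/eqP; have := ltn_ord i; lia.
Qed.

Lemma kappaN_inv N : kappaN N * \prod_(i < N) kap1 (- 'X_i) = 1.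
Proof. by rewrite -big_split /=; apply: big1 => i _; apply: kap1N. Qed.

(** [kappa_z kappa_(-z) = 1], coefficientwise. *)
Lemma q_inv (n : nat) :
  \sum_(0 <= a < n.+1) (-1) ^+ a * (q a%:Z * q (n%:Z - a%:Z)) = (n == 0%N)%:R.
Proof.
apply: symserP => N; rewrite ev_sum big_mkord.
have -> : ((n == 0%N)%:R : symser) N = cf (1 : fps {mpoly rat[N]}) n.
  by rewrite cf1; case: (n == 0%N).
rewrite -(kappaN_inv N) mulrC cfM; apply: eq_bigr => i _.
have -> : \prod_(i < N) kap1 (- 'X_i) = zscale (-1) (kappaN N).
  rewrite /kappaN (big_morph _ (@zscaleM _ _) (@zscale1 _ _)).
  by apply: eq_bigr => j _; rewrite zscale_kap1 mulN1r.
rewrite ev_sign evM !qE subzn ?qE 1?mulrA //.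
by have := ltn_ord i; lia.
Qed.

(** * The ring generated by the q_n *)

Lemma Gamma0 : Gamma 0.
Proof. by rewrite -(scale0r (1 : symser)); apply: Gamma_const. Qed.

Lemma Gamma1 : Gamma 1.
Proof. by rewrite -(scale1r (1 : symser)); apply: Gamma_const. Qed.

Lemma Gamma_scale c F : Gamma F -> Gamma (c *: F).
Proof. by move=> GF; rewrite -mulr_algl; apply: Gamma_mul => //; apply: Gamma_const. Qed.

Lemma Gamma_lin c F G : Gamma F -> Gamma G -> Gamma (c *: F + G).
Proof. by move=> GF GG; apply: Gamma_add => //; apply: Gamma_scale. Qed.

Lemma Gamma_natmul F k : Gamma F -> Gamma (F *+ k).
Proof. by move=> GF; rewrite -scaler_nat; apply: Gamma_scale. Qed.

Lemma Gamma_opp F : Gamma F -> Gamma (- F).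
Proof. by move=> GF; rewrite -scaleN1r; apply: Gamma_scale. Qed.

Lemma Gamma_sign k F : Gamma F -> Gamma ((-1) ^+ k * F).
Proof.
by move=> GF; rewrite -signr_odd; case: odd; rewrite ?mul1r // mulN1r; apply: Gamma_opp.
Qed.

Lemma Gamma_sum I (r : seq I) (P : pred I) (F : I -> symser) :
  (forall i, P i -> Gamma (F i)) -> Gamma (\sum_(i <- r | P i) F i).
Proof. by move=> GF; elim/big_ind: _ => //; [apply: Gamma0|apply: Gamma_add]. Qed.

Lemma Gamma_qz r : Gamma (q r).
Proof. by case: r => [[|n]|n]; [rewrite q0; apply: Gamma1|apply: Gamma_q|apply: Gamma0]. Qed.

(** [Gamma] is spanned by the products of the [q n]. *)
Lemma Gamma_qind (P : symser -> Prop) :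
    P 1 ->
    (forall n F, Gamma F -> P F -> P (q n.+1 * F)) ->
    (forall c F G, Gamma F -> Gamma G -> P F -> P G -> P (c *: F + G)) ->
  forall F, Gamma F -> P F.
Proof.
move=> P1 Pq Plin F GF; rewrite -(mulr1 F).
have P0 : P 0.
  by rewrite -(addNr 1) -scaleN1r; apply: Plin => //; apply: Gamma1.
have := Gamma1; move: P1; move: (1 : symser).
elim: {F} GF => [c|n|F F' GF IF GF' IF'|F F' GF IF GF' IF'] G PG GG.
- by rewrite mulr_algl -(addr0 (c *: G)); apply: Plin => //; apply: Gamma0.
- exact: Pq.
- rewrite mulrDl -(scale1r (F * G)).
  by apply: Plin; [apply: Gamma_mul|apply: Gamma_mul|apply: IF|apply: IF'].
- by rewrite -mulrA; apply: IF; [apply: IF'|apply: Gamma_mul].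
Qed.

Lemma xcoef_Mn j F k : xcoef j (F *+ k) = xcoef j F *+ k.
Proof. by rewrite -!scaler_nat xcoef_Z. Qed.

Lemma xcoef_Gamma j F : Gamma F -> Gamma (xcoef j F).
Proof.
move=> GF; elim: GF j => [c|n|F' G' _ IF _ IG|F' G' _ IF _ IG] j.
- by rewrite xcoef_const; apply: Gamma_natmul; apply: Gamma_const.
- by rewrite xcoef_q; apply: Gamma_natmul; apply: Gamma_qz.
- by rewrite xcoef_D; apply: Gamma_add.
- by rewrite xcoef_M; apply: Gamma_sum => i _; apply: Gamma_mul.
Qed.

Lemma xcoef0_id F : Gamma F -> xcoef 0 F = F.
Proof.
elim=> [c|n|F' G' _ IF _ IG|F' G' _ IF _ IG].
- by rewrite xcoef_const.
- by rewrite xcoef_q subr0.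
- by rewrite xcoef_D IF IG.
- by rewrite xcoef_M big_ord1 IF IG.
Qed.

(** Elements of [Gamma] are symmetric in the adjoined variables. *)
Lemma xcoef_comm a b F : Gamma F -> xcoef a (xcoef b F) = xcoef b (xcoef a F).
Proof.
move=> GF; elim: GF a b => [c|n|F' G' _ IF _ IG|F' G' _ IF _ IG] a b.
- by rewrite !(xcoef_const, xcoef_Mn) -!mulrnA mulnC.
- by rewrite !(xcoef_q, xcoef_Mn) -!mulrnA mulnC; congr (q _ *+ _); lia.
- by rewrite !xcoef_D IF IG.
- rewrite !xcoef_M !xcoef_sum.
  under eq_bigr do rewrite xcoef_M.
  under [in RHS]eq_bigr do rewrite xcoef_M.
  rewrite exchange_big; apply: eq_bigr => i _; apply: eq_bigr => k _.
  by rewrite IF IG.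
Qed.

Lemma xcoef_bounded F : Gamma F -> exists B, forall j, (B <= j)%N -> xcoef j F = 0.
Proof.
elim=> [c|n|F' G' _ [B BF] _ [C CG]|F' G' _ [B BF] _ [C CG]].
- by exists 1%N => -[//|j] _; rewrite xcoef_const.
- by exists n.+2 => j jn; rewrite xcoef_q q_neg ?mul0rn //; lia.
- by exists (maxn B C) => j jB; rewrite xcoef_D BF ?CG ?addr0 //; lia.
- exists (B + C)%N => j jB; rewrite xcoef_M big1 // => i _.
  by case: (leqP B i) => iB; [rewrite BF ?mul0r | rewrite CG ?mulr0 //; lia].
Qed.

(** * Vertex operators *)

Section VertexFunctional.
Variables (R : comNzRingType) (c : int -> R).
Implicit Types p : {poly R}.

(** The coefficient of [z^r] in [c(z) p(- 1 / z)]. *)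
Definition vfun (r : int) (p : {poly R}) : R :=
  \sum_(j < size p) (-1) ^+ j * (c (r + j%:Z) * p`_j).

Lemma vfunE B r (p : {poly R}) : (size p <= B)%N ->
  vfun r p = \sum_(j < B) (-1) ^+ j * (c (r + j%:Z) * p`_j).
Proof.
move=> pB; rewrite /vfun (big_ord_widen _ (fun j => (-1) ^+ j * (c (r + j%:Z) * p`_j)) pB).
rewrite big_mkcond; apply: eq_bigr => i _; case: ltnP => // pi.
by rewrite nth_default // !mulr0.
Qed.

Lemma vfunD r p p' : vfun r (p + p') = vfun r p + vfun r p'.
Proof.
pose B := maxn (size p) (size p').
rewrite (vfunE (B := B)) ?size_polyD // (@vfunE B r p) ?leq_maxl //.
rewrite (@vfunE B r p') ?leq_maxr // -big_split /=.
by apply: eq_bigr => i _; rewrite coefD !mulrDr.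
Qed.

Lemma vfunZ r a p : vfun r (a *: p) = a * vfun r p.
Proof.
rewrite (vfunE (B := size p)) ?size_scale_leq // mulr_sumr.
by apply: eq_bigr => i _; rewrite coefZ; ring.
Qed.

Lemma vfun0 r : vfun r 0 = 0.
Proof. by rewrite /vfun size_poly0 big_ord0. Qed.

Lemma vfun_sum r I (s : seq I) P (F : I -> {poly R}) :
  vfun r (\sum_(i <- s | P i) F i) = \sum_(i <- s | P i) vfun r (F i).
Proof. by rewrite (big_morph (vfun r) (vfunD r) (vfun0 r)). Qed.

Lemma vfunXM r a p : vfun r ('X^a * p) = (-1) ^+ a * vfun (r + a%:Z) p.
Proof.
rewrite (vfunE (B := (a + size p)%N)); last first.
  by rewrite (leq_trans (size_polyMleq _ _)) // size_polyXn.
rewrite big_split_ord /= big1 ?add0r => [|i _]; last first.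
  by rewrite coefXnM ltn_ord !mulr0.
rewrite mulr_sumr; apply: eq_bigr => i _.
rewrite coefXnM ltnNge leq_addr /= addKn exprD -mulrA; congr (_ * (_ * (c _ * _))).
lia.
Qed.

End VertexFunctional.

(** The coefficient of [z^r] in [kappa_z(A) F(A, x)] at [x = - 1 / z]. *)
HB.lock Definition phi (r : int) (F : symser) : symser :=
  fun N => vfun (fun i => q i N) r (addvar (F N.+1)).

Lemma phi_ev r F N : phi r F N = vfun (fun i => q i N) r (addvar (F N.+1)).
Proof. by rewrite phi.unlock. Qed.

Lemma phi_lin r c F G : phi r (c *: F + G) = c *: phi r F + phi r G.
Proof.
apply: symserP => N; rewrite evD evZ !phi_ev !(evD, evZ) raddfD /= vfunD addvarZ.
by rewrite vfunZ mul_mpolyC.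
Qed.

Lemma phi0 r : phi r 0 = 0.
Proof. by have := phi_lin r (-1) 0 0; rewrite scaler0 addr0 scaleN1r addNr. Qed.

Lemma phiZ r c F : phi r (c *: F) = c *: phi r F.
Proof. by rewrite -(addr0 (c *: F)) phi_lin phi0 addr0. Qed.

Lemma phiD r F G : phi r (F + G) = phi r F + phi r G.
Proof. by rewrite -(scale1r F) phi_lin !scale1r. Qed.

Lemma phiN r F : phi r (- F) = - phi r F.
Proof. by rewrite -scaleN1r phiZ scaleN1r. Qed.

Lemma phiMn r F k : phi r (F *+ k) = phi r F *+ k.
Proof. by rewrite -!scaler_nat phiZ. Qed.

Lemma phi_sign r k F : phi r ((-1) ^+ k * F) = (-1) ^+ k * phi r F.
Proof. by rewrite -signr_odd; case: odd; rewrite ?mul1r // !mulN1r phiN. Qed.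

Lemma phi_sum r I (s : seq I) P (F : I -> symser) :
  phi r (\sum_(i <- s | P i) F i) = \sum_(i <- s | P i) phi r (F i).
Proof. by rewrite (big_morph (phi r) (phiD r) (phi0 r)). Qed.

Lemma phiE B r F : (forall j, (B <= j)%N -> xcoef j F = 0) ->
  phi r F = \sum_(j < B) (-1) ^+ j * (q (r + j%:Z) * xcoef j F).
Proof.
move=> BF; apply: symserP => N; rewrite ev_sum phi_ev (@vfunE _ _ B).
  by apply: eq_bigr => j _; rewrite ev_sign evM xcoefE.
by apply/leq_sizeP => j /BF /(congr1 (fun F : symser => F N)); rewrite xcoefE.
Qed.

Lemma phi1 r : phi r 1 = q r.
Proof.
rewrite (@phiE 1) => [|[//|j] _]; rewrite ?xcoef_1 //.
by rewrite big_ord1 xcoef_1 addr0 mulr1 mul1r.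
Qed.

Lemma phi_Gamma r F : Gamma F -> Gamma (phi r F).
Proof.
move=> GF; have [B BF] := xcoef_bounded GF; rewrite (phiE _ BF).
apply: Gamma_sum => j _; apply: Gamma_sign; apply: Gamma_mul; first exact: Gamma_qz.
exact: xcoef_Gamma.
Qed.

Lemma addvar_q B (n : int) N : (n < B%:Z) ->
  addvar (q n N.+1) = \sum_(a < B) (q (n - a%:Z) N *+ (a != 0%N :> nat).+1) *: 'X^a.
Proof.
move=> nB; apply/polyP => j.
have /(congr1 (fun F : symser => F N)) := xcoef_q j n; rewrite xcoefE evMn => ->.
rewrite coef_sum; case: (ltnP j B) => jB.
  rewrite (bigD1 (Ordinal jB)) //= coefZ coefXn eqxx mulr1 big1 ?addr0 //.
  move=> i /eqP ni; rewrite coefZ coefXn; case: (j =P i) => [E|]; rewrite ?mulr0 //.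
  by case: ni; apply: val_inj; rewrite /= E.
rewrite q_neg ?ev0 ?mul0rn; last by lia.
rewrite big1 // => i _; rewrite coefZ coefXn; case: (j =P i) => [E|]; rewrite ?mulr0 //.
by have := ltn_ord i; lia.
Qed.

(** Moving [phi] past the multiplication by [kappa_u] produces the factor
    [(1 - u / z) / (1 + u / z)]. *)
Lemma phi_qM B r (n : int) F : n < B%:Z ->
  phi r (q n * F) = \sum_(a < B)
    (-1) ^+ a * (q (n - a%:Z) * phi (r + a%:Z) F) *+ (a != 0%N :> nat).+1.
Proof.
move=> nB; apply: symserP => N; rewrite ev_sum phi_ev evM rmorphM /=.
rewrite (addvar_q _ nB) mulr_suml vfun_sum; apply: eq_bigr => a _.
rewrite -scalerAl vfunZ vfunXM evMn ev_sign evM mulrnAl; congr (_ *+ _).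
by rewrite mulrCA phi_ev.
Qed.

(** * Anticommutation *)

(** The coefficient of [z^k] in [(1 + z) / (1 - z)] times [(1 - z) / (1 + z)]. *)
Lemma sum_kap1_conv (R : comNzRingType) k : \sum_(a < k.+1)
    (-1) ^+ (k - a)%N *+ ((a != 0%N :> nat).+1 * (k - a != 0)%N.+1) =
  (k == 0%N)%:R :> R.
Proof.
have /fpsP/(_ k) := kap1N (1 : R); rewrite cfM cf1 => <-.
by apply: eq_bigr => a _ /=; rewrite expr1n mulrnAl mulrnAr mul1r -mulrnA mulnC.
Qed.

Lemma sum_kap1_antidiag m k (R : comNzRingType) : (k <= m)%N ->
  \sum_(a < m.+1) \sum_(b < m.+1 | (a + b == k)%N)
    (-1) ^+ b *+ ((a != 0%N :> nat).+1 * (b != 0%N :> nat).+1) = (k == 0%N)%:R :> R.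
Proof.
move=> km; rewrite -sum_kap1_conv.
rewrite (big_ord_widen m.+1
  (fun a => (-1) ^+ (k - a)%N *+ ((a != 0%N).+1 * (k - a != 0)%N.+1))) //.
rewrite [RHS]big_mkcond; apply: eq_bigr => a _; case: ltnP => ak.
  have H : (k - a < m.+1)%N by lia.
  rewrite (big_pred1 (Ordinal H)) // => b; rewrite /= -val_eqE /=.
  by apply/eqP/eqP; lia.
by rewrite big_pred0 // => b; apply/eqP; lia.
Qed.

Lemma phi_q B r (s : int) : s < B%:Z ->
  phi r (q s) = \sum_(a < B)
    (-1) ^+ a * (q (s - a%:Z) * q (r + a%:Z)) *+ (a != 0%N :> nat).+1.
Proof.
move=> sB; rewrite -{1}(mulr1 (q s)) (phi_qM _ _ sB).
by apply: eq_bigr => a _; rewrite phi1.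
Qed.

Lemma phi_q_neg k (s : int) :
  phi (- k.+1%:Z) (q s) =
  if s == k.+1%:Z then ((-1) ^+ k.+1) *+ 2 else 0.
Proof.
case: (ltP s k.+1%:Z) => [sk|].
  rewrite (@phi_q `|s|.+1); last by lia.
  rewrite lt_eqF // big1 // => a _; case: (ltP s a%:Z) => sa.
    by rewrite [q (s - _)]q_neg ?mul0r ?mulr0 ?mul0rn //; lia.
  by rewrite [q (- _ + _)]q_neg ?mulr0 ?mul0rn //; lia.
move=> ks; have [t ->] : exists t : nat, s = (k.+1 + t)%:Z.
  by case: s ks => [s|s] ks; [exists (s - k.+1)%N | exists 0%N]; lia.
rewrite (@phi_q (k.+1 + t.+1)) ?big_split_ord /=; last by lia.
rewrite big1 ?add0r => [|a _]; last first.
  by rewrite [q (- _ + a%:Z)]q_neg ?mulr0 ?mul0rn //; have := ltn_ord a; lia.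
rewrite (_ : (_ == _) = (t == 0%N)); last by apply/eqP/eqP; lia.
transitivity ((-1) ^+ k.+1 * (\sum_(0 <= a < t.+1)
   (-1) ^+ a * (q a%:Z * q (t%:Z - a%:Z))) *+ 2).
  rewrite big_mkord mulr_sumr -sumrMnl; apply: eq_bigr => a _.
  rewrite exprD -mulrA; congr (_ * (_ * _) *+ _).
  by rewrite mulrC; congr (q _ * q _); lia.
by rewrite q_inv; case: (t == 0%N); rewrite ?mulr1 // mulr0 mul0rn.
Qed.

(** The two sums run over the products [q_a q_(r+s-a)] with [a >= r] and with
    [a <= r]; together they make up twice a coefficient of
    [kappa_z kappa_(-z) = 1]. *)
Lemma phi_q_sym r s : phi r (q s) + phi s (q r) =
  if r + s == 0 then ((-1) ^+ `|r|%N) *+ 2 else 0.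
Proof.
case: r s => [r|r] [s|s].
- rewrite (@phi_q s.+1) 1?(@phi_q r.+1); try lia.
  transitivity ((-1) ^+ r * (\sum_(0 <= a < r + s.+1)
     (-1) ^+ a * (q a%:Z * q ((r + s)%:Z - a%:Z))) *+ 2).
    rewrite big_mkord big_split_ord /= mulrDr mulrnDl !mulr_sumr.
    rewrite [X in X + _ = _]big_ord_recl [X in _ + X = _]big_ord_recl /=.
    rewrite [X in _ = _ + X *+ _]big_ord_recl /= !addn0.
    rewrite ?(subr0 r%:Z) ?(subr0 s%:Z) ?(addr0 r%:Z) ?(addr0 s%:Z).
    rewrite mulrA -expr2 sqrr_sign mulrnDl.
    have -> : (\sum_(i < r) (-1) ^+ r * ((-1) ^+ i * (q i%:Z * q ((r + s)%:Z - i%:Z)))) *+ 2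
        = \sum_(i < r) (-1) ^+ bump 0 i * (q (r%:Z - (bump 0 i)%:Z) * q (s%:Z + (bump 0 i)%:Z)) *+ 2.
      rewrite -sumrMnl (reindex_inj rev_ord_inj); apply: eq_bigr => i _ /=.
      rewrite mulrA -exprD /bump /= add1n -signr_odd -[in RHS]signr_odd.
      congr ((-1) ^+ nat_of_bool _ * (q _ * q _) *+ _); have := ltn_ord i; lia.
    have -> : (\sum_(i < s) (-1) ^+ r * ((-1) ^+ (r + bump 0 i) *
                 (q (r + bump 0 i)%:Z * q ((r + s)%:Z - (r + bump 0 i)%:Z)))) *+ 2
        = \sum_(i < s) (-1) ^+ bump 0 i * (q (s%:Z - (bump 0 i)%:Z) * q (r%:Z + (bump 0 i)%:Z)) *+ 2.
      rewrite -sumrMnl; apply: eq_bigr => i _ /=.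
      rewrite mulrA exprD mulrA -expr2 sqrr_sign mul1r [q _ * q _]mulrC.
      by congr (_ * (q _ * q _) *+ _); lia.
    have -> : (r + s)%:Z - r%:Z = s%:Z by lia.
    by rewrite !mulr1n expr0 !mul1r [q s * _]mulrC addrACA [RHS]addrC mulr2n !addrA.
  rewrite addnS q_inv.
  case: r s => [|r] [|s] //=; rewrite ?mulr0 ?mul0rn ?mulr1 //.
- rewrite NegzE phi_q_neg q_neg // phi0 add0r.
  by rewrite (_ : (r%:Z == _) = (r%:Z - s.+1%:Z == 0)) ?subr_eq0 //; case: eqP => // [[->]].
- rewrite NegzE phi_q_neg q_neg // phi0 addr0.
  by rewrite addrC subr_eq0.
- by rewrite !q_neg // !phi0 addr0.
Qed.

Lemma sign_absz_add (R : comNzRingType) (r : int) (a : nat) :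
  (-1) ^+ absz (r + a%:Z)%R = (-1) ^+ a * (-1) ^+ absz r :> R.
Proof.
rewrite -exprD -signr_odd -[RHS]signr_odd; congr ((-1) ^+ nat_of_bool _); lia.
Qed.

(** The relation of neutral fermions.  For [F = 1] it is [phi_q_sym].  It passes
    from [F] to [q n * F]: moving both operators past [kappa_u] multiplies it by
    [(1 - u / z) (1 - u / w) / ((1 + u / z) (1 + u / w))], which is 1 at
    [w = - z], and the right-hand side is supported there. *)
Lemma phi_anticomm r s F : Gamma F ->
  phi r (phi s F) + phi s (phi r F) =
  if r + s == 0 then ((-1) ^+ `|r|%N * F) *+ 2 else 0.
Proof.
move=> GF; elim/Gamma_qind: F / GF r s => [|n F GF IH|c F G _ _ IF IG] r s.
- by rewrite !phi1 phi_q_sym mulr1.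
- have nB : n.+1%:Z < n.+2%:Z by lia.
  (* The coefficients of the two factors from moving past q n, collected. *)
  have [w wE] : {w : nat -> nat -> symser | forall a b, w a b =
      (-1) ^+ a * ((-1) ^+ b * q (n.+1%:Z - a%:Z - b%:Z))
      *+ ((a != 0%N).+1 * (b != 0%N).+1)} by eexists.
  have E r' s' : phi r' (phi s' (q n.+1 * F)) = \sum_(b < n.+2) \sum_(a < n.+2)
      w a b * phi (r' + a%:Z) (phi (s' + b%:Z) F).
    rewrite (phi_qM _ _ nB) phi_sum; apply: eq_bigr => b _.
    rewrite phiMn phi_sign (@phi_qM n.+2); last by lia.
    rewrite mulr_sumr -sumrMnl; apply: eq_bigr => a _.
    rewrite wE mulrnAr -mulrnA mulrnAl; congr (_ *+ _).
    rewrite mulrCA !mulrA; congr (_ * q _ * _); lia.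
  rewrite !E [X in _ + X]exchange_big -big_split /=.
  have wC a b : w a b = w b a.
    rewrite !wE mulrCA mulnC; congr (_ * (_ * q _) *+ _); lia.
  transitivity (\sum_(b < n.+2) \sum_(a < n.+2) w a b *
      (if r + s + (a + b)%:Z == 0 then ((-1) ^+ absz (r + a%:Z)%R * F) *+ 2 else 0)).
    apply: eq_bigr => b _; rewrite -big_split; apply: eq_bigr => a _ /=.
    by rewrite [w b a]wC -mulrDr IH addrACA -PoszD.
  case: (ltP 0 (r + s)) => [rs0|rs0].
    rewrite gt_eqF // big1 // => b _; rewrite big1 // => a _.
    by rewrite gt_eqF ?mulr0 //; lia.
  have [k rsk] : exists k : nat, r + s = - k%:Z.
    by exists (absz (r + s)%R); lia.
  pose C : symser := ((-1) ^+ `|r|%N * (q (n.+1%:Z - k%:Z) * F)) *+ 2.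
  transitivity (C * \sum_(a < n.+2) \sum_(b < n.+2 | (a + b == k)%N)
    (-1) ^+ b *+ ((a != 0%N :> nat).+1 * (b != 0%N :> nat).+1)).
    rewrite exchange_big mulr_sumr; apply: eq_bigr => a _ /=.
    rewrite mulr_sumr [RHS]big_mkcond; apply: eq_bigr => b _ /=.
    have -> : (r + s + (a + b)%:Z == 0) = (a + b == k)%N.
      by rewrite rsk; apply/eqP/eqP; lia.
    case: eqP => [abk|]; last by rewrite mulr0.
    rewrite wE /C !(mulrnAl, mulrnAr) -!mulrnA.
    have -> : n.+1%:Z - a%:Z - b%:Z = n.+1%:Z - k%:Z by lia.
    rewrite mulnC; congr (_ *+ _).
    have aux (x y z u v : symser) :
      x * (y * u) * (x * z * v) = x * x * (z * (u * v) * y) by ring.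
    by rewrite sign_absz_add aux -expr2 sqrr_sign mul1r.
  case: (leqP k n.+1) => kn.
    rewrite sum_kap1_antidiag // rsk oppr_eq0 /C; case: k {rsk kn C} => [|k].
      by rewrite subr0 mulr1.
    by rewrite mulr0.
  have -> : (r + s == 0) = false by rewrite rsk; apply/eqP; lia.
  by rewrite /C q_neg ?mul0r ?mulr0 ?mul0rn ?mul0r //; lia.
- rewrite !phi_lin addrACA -scalerDr IF IG; case: eqP => _.
    by rewrite mulrDr mulrnDl -scalerAr scalerMnr.
  by rewrite scaler0 addr0.
Qed.

(** * Words in the vertex operators *)

Lemma xcoef_phi n t F : Gamma F ->
  xcoef n (phi t F) = \sum_(a < n.+1) phi (t - a%:Z) (xcoef (n - a) F) *+ (a != 0%N :> nat).+1.
Proof.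
move=> GF; have [B BF] := xcoef_bounded GF.
rewrite (phiE t BF) xcoef_sum.
under eq_bigr => j _ do rewrite xcoef_sign xcoef_M mulr_sumr.
rewrite exchange_big; apply: eq_bigr => a _ /=.
rewrite (@phiE B) => [|j jB]; last by rewrite xcoef_comm // BF // xcoef_0.
rewrite -sumrMnl; apply: eq_bigr => j _.
by rewrite xcoef_q mulrnAl mulrnAr (xcoef_comm _ _ GF) addrAC.
Qed.

Definition word (l : seq int) (F : symser) : symser := foldr phi F l.
(** The word applied to the vacuum 1; by [QE] below this is [Q l]. *)
Notation vac l := (word l 1).

Lemma word_Gamma l F : Gamma F -> Gamma (word l F).
Proof. by move=> GF; elim: l => //= t l; apply: phi_Gamma. Qed.

Lemma vac_Gamma l : Gamma (vac l).
Proof. exact: word_Gamma Gamma1. Qed.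

Lemma word0 l : word l 0 = 0.
Proof. by elim: l => //= t l ->; rewrite phi0. Qed.

(** Anticommuting [phi t] through a word to its right end. *)
Lemma phi_word t l F : Gamma F ->
  phi t (word l F) =
  \sum_(j < size l) (if t + l`_j == 0
     then (-1) ^+ j * ((-1) ^+ `|t|%N * word (del_nth j l) F) *+ 2 else 0)
  + (-1) ^+ size l * word l (phi t F).
Proof.
move=> GF; elim: l => [|s l IH] /=; first by rewrite big_ord0 add0r mul1r.
have -> : phi t (phi s (word l F)) =
    (if t + s == 0 then ((-1) ^+ `|t|%N * word l F) *+ 2 else 0) -
    phi s (phi t (word l F)).
  by rewrite -phi_anticomm ?addrK //; apply: word_Gamma.
rewrite IH phiD phi_sum opprD addrA phi_sign.
rewrite [(-1) ^+ (size l).+1]exprS -mulrA mulN1r; congr (_ - _).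
rewrite big_ord_recl /= expr0 mul1r /del_nth /= drop0; congr (_ + _).
rewrite -sumrN; apply: eq_bigr => j _; rewrite add0n.
case: eqP => _; last by rewrite phi0 oppr0.
by rewrite phiMn !phi_sign -mulNrn exprS mulN1r mulNr.
Qed.

Lemma phi_neg1 k : phi (- k.+1%:Z) 1 = 0.
Proof. by rewrite phi1 q_neg //; lia. Qed.

Lemma q_ev0 r : q r 0%N = (r == 0)%:R.
Proof.
case: r => [n|n]; last by rewrite q_neg.
rewrite qE /kappaN big_ord0 cf1; congr (nat_of_bool _)%:R.
Qed.

(** Over the empty alphabet only the term [q_0] survives. *)
Lemma phi_ev0 t F : 0 < t -> phi t F 0%N = 0.
Proof.
move=> t0; rewrite phi_ev /vfun big1 // => j _.
by rewrite q_ev0 gt_eqF ?mul0r ?mulr0 //; lia.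
Qed.

Lemma phi0_ev0 F : Gamma F -> phi 0 F 0%N = F 0%N.
Proof.
move=> GF; have [B BF] := xcoef_bounded GF.
rewrite (@phiE B.+1) => [|j jB]; last by rewrite BF // ltnW.
rewrite ev_sum big_ord_recl big1 ?addr0 => [|j _].
  by rewrite expr0 mul1r evM q_ev0 xcoef0_id //; apply: mul1r.
by rewrite ev_sign evM q_ev0 gt_eqF ?mul0r ?mulr0 //; lia.
Qed.

Lemma mulr2n_inj (V : lmodType rat) (x y : V) : x *+ 2 = y *+ 2 -> x = y.
Proof.
move=> /(congr1 (fun z => 2%:R^-1 *: z)).
by rewrite -!scaler_nat !scalerA mulVf ?scale1r.
Qed.

(** A letter [t < 0] is moved to the right end, where it kills 1; for [t > 0]
    both sides vanish.  The letter 0 acts as the identity at both ends of the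
    word, and moving it past an odd number of letters changes the sign, so that
    the anticommutators add up to twice the left-hand side. *)
Lemma wick_ev0 t l : odd (size l) ->
  vac (t :: l) 0%N = \sum_(j < size l)
    (-1) ^+ j * (vac [:: t; l`_j] 0%N * vac (del_nth j l) 0%N).
Proof.
move=> ol; rewrite [word _ _]/=.
have [t0|t0|->] := ltgtP t 0.
- have [k ->] : exists k, t = - k.+1%:Z by exists (absz t).-1; lia.
  rewrite phi_word; last exact: Gamma1.
  rewrite phi_neg1 word0 mulr0 addr0 ev_sum; apply: eq_bigr => j _.
  rewrite /= phi1 phi_q_neg [- _ + _]addrC subr_eq0.
  case: eqP => _; last by rewrite ev0 mul0r mulr0.
  by rewrite evMn evMn !ev_sign evX evN ev1 mulrnAl mulrnAr.
- rewrite phi_ev0 // big1 // => j _.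
  by rewrite [word _ _]/= phi_ev0 // mul0r mulr0.
rewrite phi0_ev0; last exact: vac_Gamma.
have /(congr1 (fun F : symser => F 0%N)) := phi_word 0 l Gamma1.
rewrite phi0_ev0; last exact: vac_Gamma.
rewrite phi1 q0 -(signr_odd _ (size l)) ol expr1 mulN1r evD evN => /eqP.
rewrite -subr_eq opprK -mulr2n => /eqP E; apply: mulr2n_inj; rewrite {}E.
rewrite ev_sum -sumrMnl; apply: eq_bigr => j _.
rewrite [vac [:: _; _]]/= phi0_ev0 ?phi1 ?q_ev0; last exact: Gamma_qz.
rewrite add0r; case: eqP => _; last by rewrite mul0r mulr0 mul0rn.
by rewrite mul1r evMn !ev_sign mul1r.
Qed.

(** * Shift operators and the Pfaffian expansion of words *)

Definition shift (i a : nat) (r : nat -> int) : nat -> int :=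
  fun x => if x == i then r x - a%:Z else r x.

Lemma shiftC i a j b r : shift i a (shift j b r) = shift j b (shift i a r).
Proof.
apply: functional_extensionality_dep => x; rewrite /shift.
by case: eqP => _; case: eqP => _ //; rewrite addrAC.
Qed.

Lemma map_shift i a r l : i \notin l -> map (shift i a r) l = map r l.
Proof.
move=> il; apply/eq_in_map => x xl; rewrite /shift ifF //.
by apply: contraNF il => /eqP <-.
Qed.

Definition indep (S : Type) (i : nat) (f : (nat -> int) -> S) :=
  forall a r, f (shift i a r) = f r.

(** Multiplication by [(1 + x S_i) / (1 - x S_i)], where [S_i] lowers the
    [i]-th argument. *)
Definition kshift (S : comNzRingType) (i : nat) (f : (nat -> int) -> fps S) :
    (nat -> int) -> fps S :=
  fun r => Fps (fun n =>
    \sum_(a < n.+1) cf (f (shift i a r)) (n - a) *+ (a != 0%N :> nat).+1).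

Definition kshifts (S : comNzRingType) (l : seq nat) f := foldr (@kshift S) f l.

(** Both sides run over the triangle [a + b <= n]. *)
Lemma exchange_tri (V : nmodType) n (G : nat -> nat -> V) :
  \sum_(a < n.+1) \sum_(b < (n - a).+1) G a b =
  \sum_(b < n.+1) \sum_(a < (n - b).+1) G a b.
Proof.
have H (F : nat -> V) a : \sum_(b < (n - a).+1) F b =
    \sum_(b < n.+1) if (b <= n - a)%N then F b else 0.
  by rewrite (big_ord_widen n.+1 F) ?ltnS ?leq_subr // big_mkcond.
under eq_bigr => a _ do rewrite (H (G a) a).
rewrite exchange_big; apply: eq_bigr => b _ /=.
rewrite (H (G^~ b) b); apply: eq_bigr => a _.
by have := ltn_ord a; have := ltn_ord b; do 2! case: ifP => //; lia.
Qed.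

Section ShiftOperators.
Variable S : comNzRingType.
Implicit Types f g : (nat -> int) -> fps S.

Lemma kshiftC i j f : kshift i (kshift j f) = kshift j (kshift i f).
Proof.
apply: functional_extensionality_dep => r; apply/fpsP => n /=.
pose G a b := cf (f (shift i a (shift j b r))) (n - a - b)
  *+ ((a != 0%N).+1 * (b != 0%N).+1).
transitivity (\sum_(a < n.+1) \sum_(b < (n - a).+1) G a b).
  apply: eq_bigr => a _; rewrite -sumrMnl; apply: eq_bigr => b _.
  by rewrite /G -mulrnA mulnC shiftC.
rewrite exchange_tri; apply: eq_bigr => b _; rewrite -sumrMnl.
by apply: eq_bigr => a _; rewrite /G -mulrnA subnAC.
Qed.

Lemma kshifts_move l1 j l2 f : kshifts (l1 ++ j :: l2) f = kshift j (kshifts (l1 ++ l2) f).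
Proof. by elim: l1 => //= i l1 IH; rewrite IH kshiftC. Qed.

Lemma kshifts_cat l1 l2 f : kshifts (l1 ++ l2) f = kshifts l1 (kshifts l2 f).
Proof. by rewrite /kshifts foldr_cat. Qed.

Lemma kshift_indep i j f : indep i f -> indep i (kshift j f).
Proof.
move=> fi a r; apply/fpsP => n; apply: eq_bigr => b _.
by rewrite shiftC fi.
Qed.

Lemma kshifts_indep i l f : indep i f -> indep i (kshifts l f).
Proof. by move=> fi; elim: l => //= j l; apply: kshift_indep. Qed.

Lemma kshift_mull i f g : indep i f ->
  kshift i (fun r => f r * g r) = (fun r => f r * kshift i g r).
Proof.
move=> fi; apply: functional_extensionality_dep => r; apply/fpsP => n.
rewrite cfM /=.
pose G a m := cf (f r) m * cf (g (shift i a r)) (n - a - m) *+ (a != 0%N).+1.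
transitivity (\sum_(a < n.+1) \sum_(m < (n - a).+1) G a m).
  apply: eq_bigr => a _; rewrite -sumrMnl; apply: eq_bigr => m _.
  by rewrite fi.
rewrite exchange_tri; apply: eq_bigr => m _; rewrite mulr_sumr.
by apply: eq_bigr => a _; rewrite /G mulrnAr subnAC.
Qed.

Lemma kshifts_mull l f g : (forall i, i \in l -> indep i f) ->
  kshifts l (fun r => f r * g r) = (fun r => f r * kshifts l g r).
Proof.
elim: l => //= i l IH fl; rewrite IH => [|j jl]; last first.
  by apply: fl; rewrite inE jl orbT.
by rewrite kshift_mull //; apply: fl; rewrite inE eqxx.
Qed.

Lemma kshifts_mul l1 l2 f g :
    (forall i, i \in l2 -> indep i f) -> (forall i, i \in l1 -> indep i g) ->
  kshifts (l1 ++ l2) (fun r => f r * g r) = (fun r => kshifts l1 f r * kshifts l2 g r).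
Proof.
move=> fl gl; rewrite kshifts_cat (kshifts_mull _ fl).
under eq_fun do rewrite mulrC.
rewrite kshifts_mull => [|i il]; last by apply: kshifts_indep; apply: gl.
by under eq_fun do rewrite mulrC.
Qed.

Lemma kshifts_lin I (s : seq I) (c : I -> nat) l (F : I -> (nat -> int) -> fps S) r n :
  cf (kshifts l (fun r => \sum_(j <- s) (-1) ^+ c j * F j r) r) n =
  \sum_(j <- s) (-1) ^+ c j * cf (kshifts l (F j) r) n.
Proof.
elim: l r n => [|i l IH] r n /=.
  rewrite cf_sum; apply: eq_bigr => j _.
  by rewrite -!(signr_odd _ (c j)); case: odd; rewrite ?mul1r ?mulN1r ?cfN.
under eq_bigr do rewrite IH -sumrMnl.
rewrite exchange_big; apply: eq_bigr => j _; rewrite mulr_sumr.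
by apply: eq_bigr => a _; rewrite mulrnAr.
Qed.

End ShiftOperators.

Lemma kshifts_ev N l (f g : (nat -> int) -> fps symser) :
    (forall r n, cf (f r) n N = cf (g r) n N) ->
  forall r n, cf (kshifts l f r) n N = cf (kshifts l g r) n N.
Proof.
move=> fg; elim: l => //= i l IH r n; rewrite !ev_sum.
by apply: eq_bigr => a _; rewrite !evMn IH.
Qed.

Definition const_fps (F : symser) : fps symser := Fps (fun n => F *+ (n == 0%N)).

Lemma cf_const_fps F n : cf (const_fps F) n = F *+ (n == 0%N). Proof. by []. Qed.

Lemma const_fpsM F G : const_fps (F * G) = const_fps F * const_fps G.
Proof.
apply/fpsP => n; rewrite cfM big_ord_recl big1 ?addr0 => [|i _] /=.
  by rewrite subn0 mulr1n mulrnAr.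
by rewrite mulr0n mul0r.
Qed.

Lemma kshifts_phi i l (g : (nat -> int) -> symser) r n : i \notin l ->
  cf (kshifts l (fun r => const_fps (phi (r i) (g r))) r) n =
  phi (r i) (cf (kshifts l (fun r => const_fps (g r)) r) n).
Proof.
elim: l r n => [|j l IH] r n; first by move=> _ /=; rewrite phiMn.
rewrite inE negb_or => /andP[ij il] /=; rewrite phi_sum.
by apply: eq_bigr => a _; rewrite phiMn IH // /shift (negbTE ij).
Qed.

Definition xser (F : symser) : fps symser := Fps (fun n => xcoef n F).

(** Adjoining a variable [x] multiplies the generating function of the words
    by the product of the [(1 + u x) / (1 - u x)]. *)
Lemma xser_vac l r : uniq l ->
  xser (vac (map r l)) = kshifts l (fun r => const_fps (vac (map r l))) r.
Proof.
elim: l r => [|i l IH] r.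
  by move=> _; apply/fpsP => n /=; rewrite xcoef_1; case: eqP.
move=> /= /andP[il ul]; apply/fpsP => n /=.
rewrite xcoef_phi; last exact: vac_Gamma.
apply: eq_bigr => a _; congr (_ *+ _).
rewrite kshifts_phi // /shift eqxx; congr (phi _ _).
have /fpsP/(_ (n - a)%N) /= -> := IH r ul.
rewrite -/(shift i a r) (kshifts_indep l (i := i)) // => b r'.
by rewrite map_shift.
Qed.

Lemma xser_mul F G : xser (F * G) = xser F * xser G.
Proof. by apply/fpsP => n /=; rewrite xcoef_M. Qed.

Lemma uniq_nth_del (Y : eqType) (x0 : Y) j l : uniq l -> (j < size l)%N ->
  uniq (nth x0 l j :: del_nth j l).
Proof.
move=> ul jl; rewrite -(perm_uniq (s1 := l)) //.
by rewrite -{1}(cat_take_drop j l) (drop_nth x0) // perm_catC /= perm_cons perm_catC.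
Qed.

Lemma map_del (Y Z : Type) (f : Y -> Z) j l : map f (del_nth j l) = del_nth j (map f l).
Proof. by rewrite /del_nth map_cat map_take map_drop. Qed.

(** The expansion holds over the empty alphabet, and both sides change in the
    same way when a variable is adjoined. *)
Lemma wick_map N r i l : uniq (i :: l) -> odd (size l) ->
  vac (map r (i :: l)) N = \sum_(j < size l)
    (-1) ^+ j * (vac [:: r i; r (nth 0%N l j)] N * vac (map r (del_nth j l)) N).
Proof.
move=> uil ol; elim: N r => [|N IH] r.
  rewrite map_cons wick_ev0 size_map //; apply: eq_bigr => j _.
  by rewrite map_del (nth_map 0%N).
pose P r := \sum_(j < size l)
    (-1) ^+ j * (vac [:: r i; r (nth 0%N l j)] * vac (map r (del_nth j l))) : symser.
have PE r' M : P r' M = \sum_(j < size l) (-1) ^+ j *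
    (vac [:: r' i; r' (nth 0%N l j)] M * vac (map r' (del_nth j l)) M).
  by rewrite /P ev_sum; apply: eq_bigr => j _; rewrite ev_sign evM.
rewrite -PE.
(* Compare the coefficients of the powers of the adjoined variable. *)
suff key n : xcoef n (vac (map r (i :: l))) N = xcoef n (P r) N.
  by apply: addvar_inj; apply/polyP => n; move: (key n); rewrite !xcoefE.
rewrite -[xcoef n _]/(cf (xser _) n) (xser_vac r uil).
rewrite (@kshifts_ev N _ _ (fun r => const_fps (P r))) => [|r' k]; last first.
  by rewrite !cf_const_fps !evMn IH PE.
have -> : (fun r => const_fps (P r)) = fun r => \sum_(j < size l) (-1) ^+ j *
    (const_fps (vac [:: r i; r (nth 0%N l j)]) * const_fps (vac (map r (del_nth j l)))).
  apply: functional_extensionality_dep => r'.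
  apply/fpsP => k; rewrite cf_sum cf_const_fps /P -sumrMnl; apply: eq_bigr => j _.
  rewrite -const_fpsM -!(signr_odd _ j); case: odd; rewrite ?expr0 ?mul1r ?cf_const_fps //.
  by rewrite expr1 !mulN1r cfN cf_const_fps mulNrn.
rewrite kshifts_lin /P xcoef_sum !ev_sum; apply: eq_bigr => j _.
rewrite xcoef_sign; apply: (congr1 (fun G : symser => ((-1) ^+ j * G) N)).
have jl := ltn_ord j.
have /andP[il ul] := uil.
have u2 := uniq_nth_del 0%N ul jl.
set lj := nth 0%N l j in u2 *; set l' := del_nth j l in u2 *.
have Kl : forall f : (nat -> int) -> fps symser,
    kshifts (i :: l) f = kshifts ([:: i; lj] ++ l') f.
  move=> f; rewrite /= -[l in LHS](cat_take_drop j) (drop_nth 0%N) //.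
  by rewrite kshifts_move.
have il' : i \notin l'.
  by apply: contra il; rewrite /l' /del_nth mem_cat => /orP[/mem_take|/mem_drop].
have /andP[ljl' ul'] := u2.
have ilj : i != lj by apply: contraNneq il => ->; apply: mem_nth.
have E1 := @xser_vac [:: i; lj] r; rewrite /= inE ilj in E1.
rewrite Kl kshifts_mul => [|x xl' a r'|x xl a r'].
- by rewrite -[kshifts [:: _; _] _ r]E1 // -xser_vac // -xser_mul.
- by rewrite /shift !ifF //; apply: contraTF xl' => /eqP <-.
- by rewrite /= map_shift //; move: xl; rewrite !inE => /orP[]/eqP->.
Qed.

(** The words satisfy the expansion of a Pfaffian along its first row. *)
Lemma wick t l : odd (size l) ->
  vac (t :: l) = \sum_(j < size l)
    (-1) ^+ j * (vac [:: t; l`_j] * vac (del_nth j l)).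
Proof.
move=> ol; apply: symserP => N; rewrite ev_sum.
pose r x := nth 0 (t :: l) x.
have E : map r (iota 1 (size l)) = l.
  apply: (@eq_from_nth _ 0); first by rewrite size_map size_iota.
  move=> j; rewrite size_map size_iota => jl.
  by rewrite (nth_map 0%N) ?size_iota // nth_iota // add1n.
have := @wick_map N r 0%N (iota 1 (size l)).
rewrite -/(iota 0 (size l).+1) iota_uniq size_iota => /(_ isT ol).
rewrite map_cons E => ->; apply: eq_bigr => j _.
by rewrite ev_sign evM map_del E nth_iota // add1n.
Qed.

(** * Pfaffians *)

(** [lift_perm i j] is a bijection onto the permutations sending [i] to [j]. *)
Lemma sum_lift_perm (R : nmodType) n (i j : 'I_n.+1) (F : 'S_n.+1 -> R) :
  \sum_(s : 'S_n.+1 | s i == j) F s = \sum_(s : 'S_n) F (lift_perm i j s).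
Proof.
rewrite (reindex (lift_perm i j)) /=.
  by apply: eq_bigl => s; rewrite lift_perm_id eqxx.
have key (s : 'S_n.+1) : s i = j -> exists t : 'S_n, s = lift_perm i j t.
  move=> sij; pose f k := odflt k (unlift j (s (lift i k))).
  have fE k : lift j (f k) = s (lift i k).
    rewrite /f; have : j != s (lift i k).
      by rewrite -sij (inj_eq perm_inj) neq_lift.
    by case/unlift_some => k' -> ->.
  have f_inj : injective f.
    move=> k k' /(congr1 (lift j)); rewrite !fE => /perm_inj; exact: lift_inj.
  exists (perm f_inj); apply/permP => k.
  case: (unliftP i k) => [k'|] ->; last by rewrite lift_perm_id.
  by rewrite lift_perm_lift permE fE.
have lp_inj : injective (@lift_perm n i j).
  move=> s t /permP st; apply/permP => k; apply: (@lift_inj _ j).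
  by rewrite -!(lift_perm_lift i j) st.
exists (fun s => odflt 1%g [pick t | s == lift_perm i j t]) => [t _|s].
  case: pickP => [t' /eqP /lp_inj //|/(_ t)]; by rewrite eqxx.
rewrite inE => /eqP /key [t ->]; case: pickP => [t' /eqP //|/(_ t)].
by rewrite eqxx.
Qed.

Section PfaffianRow.
Variables (R : comAlgType rat).

Notation ev i := (Ordinal (even_ord_subproof i)).
Notation od i := (Ordinal (odd_ord_subproof i)).

Definition pfterm h (A : 'M[R]_(h.*2)) (s : 'S_(h.*2)) : R :=
  (-1) ^+ s * \prod_(i < h) A (s (ev i)) (s (od i)).

Lemma ev_inj h (i k : 'I_h) : (ev i == ev k) = (i == k).
Proof. by rewrite -!val_eqE /= -!mul2n eqn_mul2l. Qed.
Lemma od_inj h (i k : 'I_h) : (od i == od k) = (i == k).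
Proof. by rewrite -!val_eqE /= eqSS -!mul2n eqn_mul2l. Qed.
Lemma ev_od h (i k : 'I_h) : (ev i == od k) = false.
Proof. by apply/eqP => /(congr1 val) /=; lia. Qed.
Lemma od_ev h (i k : 'I_h) : (od i == ev k) = false.
Proof. by rewrite eq_sym ev_od. Qed.

(** Exchanging two pairs of positions is an even permutation, and permutes the
    factors of the product. *)
Lemma pfterm_block h (A : 'M[R]_(h.*2)) (s : 'S_(h.*2)) (i k : 'I_h) :
  pfterm A (tperm (ev i) (ev k) * tperm (od i) (od k) * s)%g = pfterm A s.
Proof.
rewrite /pfterm !odd_permM !odd_tperm ev_inj od_inj addbb addFb; congr (_ * _).
rewrite [RHS](reindex_inj (@perm_inj _ (tperm i k))); apply: eq_bigr => j _.
have E : (tperm (ev i) (ev k) * tperm (od i) (od k))%g (ev j) = ev (tperm i k j).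
  rewrite permM; case: (tpermP i k j) => [->|->|/eqP ji /eqP jk].
  - by rewrite tpermL tpermD // od_ev.
  - by rewrite tpermR tpermD // od_ev.
  - by rewrite !tpermD // ?od_ev // ev_inj eq_sym.
have O : (tperm (ev i) (ev k) * tperm (od i) (od k))%g (od j) = od (tperm i k j).
  rewrite permM [tperm (ev i) _ _]tpermD ?ev_od //.
  case: (tpermP i k j) => [->|->|/eqP ji /eqP jk].
  - by rewrite tpermL.
  - by rewrite tpermR.
  - by rewrite !tpermD // od_inj eq_sym.
by rewrite !(permM _ s) E O.
Qed.

(** Exchanging the two positions of a pair changes the sign of the permutation
    and of one factor. *)
Lemma pfterm_swap h (A : 'M[R]_(h.*2)) (s : 'S_(h.*2)) (i : 'I_h) :
  (forall x y, A y x = - A x y) -> pfterm A (tperm (ev i) (od i) * s)%g = pfterm A s.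
Proof.
move=> skew; rewrite /pfterm odd_permM odd_tperm ev_od /= signrN mulNr -mulrN; congr (_ * _).
rewrite (bigD1 i) //= [in RHS](bigD1 i) //= !permM tpermL tpermR skew.
rewrite mulNr opprK; congr (_ * _); apply: eq_bigr => j ji.
by rewrite !permM !tpermD // ?ev_inj ?od_inj ?ev_od ?od_ev // eq_sym.
Qed.

(** Exchanging pairs of positions, or the two positions of a pair, moves the
    value 0 to position 0; its [2 (h + 1)] possible positions account for the
    change of the normalizing factor. *)
Lemma pfaffian_row h (A : 'M[R]_(h.*2.+2)) : (forall x y, A y x = - A x y) ->
  pfaffian (h := h.+1) A = \sum_(j < h.*2.+1) (-1) ^+ j *
    (A ord0 (lift ord0 j) *
     pfaffian (\matrix_(x, y) A (lift ord0 (lift j x)) (lift ord0 (lift j y)))).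
Proof.
move=> skew; pose f := pfterm (h := h.+1) A.
have Sp (p : 'I_(h.+1).*2) :
    \sum_(s : 'S_(h.+1).*2 | s p == ord0) f s =
    \sum_(s : 'S_(h.+1).*2 | s ord0 == ord0) f s.
  have i_lt : (p./2 < h.+1)%N by have := ltn_ord p; rewrite -divn2; lia.
  pose i := Ordinal i_lt.
  have ev0 : ev (ord0 : 'I_h.+1) = ord0 by apply: val_inj.
  have Sev : \sum_(s : 'S_(h.+1).*2 | s (ev i) == ord0) f s =
      \sum_(s : 'S_(h.+1).*2 | s ord0 == ord0) f s.
    rewrite (reindex_inj (mulgI (tperm (ev i) (ev ord0) * tperm (od i) (od ord0))%g)).
    apply: eq_big => [s|s _]; last exact: pfterm_block.
    by rewrite !permM tpermL tpermD ?ev0 // -ev0 od_ev.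
  have [op|ep] := boolP (odd p); last first.
    by have -> : p = ev i by apply: val_inj; rewrite /= halfK (negbTE ep) subn0.
  have -> : p = od i by apply: val_inj; rewrite /= halfK op; have := odd_gt0 op; lia.
  rewrite -Sev (reindex_inj (mulgI (tperm (ev i) (od i)))).
  by apply: eq_big => [s|s _]; [rewrite permM tpermR | apply: pfterm_swap].
have -> : pfaffian (h := h.+1) A =
    ((2 ^ h.+1 * h.+1`!)%:R : rat)^-1 *: ((\sum_(s : 'S_(h.+1).*2 | s ord0 == ord0) f s)
      *+ (h.+1).*2).
  rewrite /pfaffian; congr (_ *: _).
  rewrite (partition_big (fun s : 'S_(h.+1).*2 => (s^-1)%g ord0) xpredT) //=.
  transitivity (\sum_(p < (h.+1).*2) \sum_(s : 'S_(h.+1).*2 | s ord0 == ord0) f s).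
    apply: eq_bigr => p _; rewrite -(Sp p); apply: eq_bigl => s.
    by rewrite -(inj_eq (@perm_inj _ s)) permKV eq_sym.
  by rewrite sumr_const card_ord.
rewrite -scaler_nat scalerA.
have -> : ((2 ^ h.+1 * h.+1`!)%:R : rat)^-1 * ((h.+1).*2)%:R = ((2 ^ h * h`!)%:R)^-1.
  have -> : (2 ^ h.+1 * h.+1`! = (h.+1).*2 * (2 ^ h * h`!))%N.
    by rewrite expnS factS -mul2n; ring.
  by rewrite natrM invfM mulrC mulrA mulfV ?mul1r // Num.Theory.pnatr_eq0.
rewrite (@sum_lift_perm _ h.*2.+1 ord0 ord0 f).
rewrite (partition_big (fun s : 'S_h.*2.+1 => s ord0) xpredT) //= scaler_sumr.
apply: eq_bigr => j _; rewrite sum_lift_perm /pfaffian -!scalerAr; congr (_ *: _).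
rewrite mulrA mulr_sumr; apply: eq_bigr => s _.
rewrite /f /pfterm !odd_lift_perm /= signr_addb signr_odd -!mulrA; congr (_ * _).
rewrite [in RHS]mulrCA; congr (_ * _); rewrite big_ord_recl.
have -> : ev (ord0 : 'I_h.+1) = (ord0 : 'I_h.*2.+2) by apply: val_inj.
have -> : od (ord0 : 'I_h.+1) = (lift ord0 ord0 : 'I_h.*2.+2) by apply: val_inj.
rewrite lift_perm_lift !lift_perm_id; congr (_ * _); apply: eq_bigr => i _.
have -> : ev (lift ord0 i) = lift ord0 (lift ord0 (ev i)) by apply: val_inj.
have -> : od (lift ord0 i) = lift ord0 (lift ord0 (od i)) by apply: val_inj.
by rewrite !lift_perm_lift mxE.
Qed.

End PfaffianRow.

Lemma Q2E r s : Q2 r s = vac [:: r; s].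
Proof.
rewrite /= phi1 /Q2; case: s => [s|s]; last first.
  by rewrite big_geq // [q (Negz s)]q_neg // phi0 !mulr0 addr0.
rewrite (@phi_q s.+1); last by lia.
rewrite -(big_mkord xpredT (fun a : nat =>
  (-1) ^+ a * (q (s%:Z - a%:Z) * q (r + a%:Z)) *+ (a != 0%N).+1)).
rewrite big_ltn // expr0 mul1r mulr1n addr0 subr0 mulrC; congr (_ + _).
rewrite mulr_sumr; apply: eq_big_nat => a /andP[a0 _].
by rewrite -lt0n a0 mulr_natl [q (r + _) * _]mulrC.
Qed.

Lemma nth_del (Y : Type) (x0 : Y) j i l : (j < size l)%N ->
  nth x0 (del_nth j l) i = nth x0 l (bump j i).
Proof.
move=> jl; rewrite /del_nth nth_cat size_take jl /bump.
case: ltnP => ij; first by rewrite nth_take.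
by rewrite nth_drop; congr (nth _ _ _); lia.
Qed.

Lemma size_del (Y : Type) j (l : seq Y) : (j < size l)%N ->
  size (del_nth j l) = (size l).-1.
Proof. by move=> jl; rewrite /del_nth size_cat size_take size_drop jl; lia. Qed.

Lemma pfaffian_word h l : size l = h.*2 -> pfaffian (Q_mx l h) = vac l.
Proof.
elim: h l => [|h IH] l.
  move=> /size0nil -> /=; rewrite /pfaffian expn0 mul1n fact0 invr1 scale1r.
  rewrite (big_pred1 1%g) => [|s]; first by rewrite odd_perm1 expr0 mul1r big_ord0.
  by apply/esym/eqP/permP => -[].
case: l => [|t l]; rewrite doubleS // => -[sl].
have skew x y : Q_mx (t :: l) h.+1 y x = - Q_mx (t :: l) h.+1 x y.
  by rewrite !mxE; case: ltngtP => _; rewrite ?opprK ?oppr0.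
rewrite (pfaffian_row skew) wick; last by rewrite sl /= odd_double.
rewrite sl; apply: eq_bigr => j _; congr (_ * (_ * _)).
  by rewrite mxE /= add0n Q2E.
have jl : (j < size l)%N by rewrite sl.
rewrite -IH; last by rewrite size_del // sl.
congr (pfaffian _); apply/matrixP => x y; rewrite !mxE /= !add0n ![bump 0 _]add1n.
rewrite !nth_del // !ltnS.
have b (u v : nat) : (bump j u < bump j v)%N = (u < v)%N.
  by rewrite /bump; do 2! case: leqP => /=; lia.
by rewrite !b.
Qed.

(** A zero part may be appended since [phi 0 1 = 1]. *)
Lemma QE lam : Q lam = vac lam.
Proof.
rewrite /Q; case: ifP => od.
  rewrite pfaffian_word; last by rewrite size_rcons; have := odd_double_half (size lam).+1; lia.
  by rewrite /word foldr_rcons phi1 q0.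
by rewrite pfaffian_word //; have := odd_double_half (size lam); lia.
Qed.

(** * The operator D_k on the ring generated by the q_n *)

Definition spart_rel (x y : nat) := (y < x)%N || (x == 0%N) && (y == 0%N).

Lemma spart_rel_trans : transitive spart_rel.
Proof. by move=> y x z; rewrite /spart_rel; lia. Qed.

Lemma strict_partitionE lam : strict_partition lam = sorted spart_rel lam.
Proof.
rewrite /strict_partition; elim: lam => //= x l IH.
rewrite (path_sortedE spart_rel_trans) -IH path_sortedE; last first.
  by move=> a b c /=; lia.
case: (eqVneq x 0%N) => [->|x0] /=.
  have -> : all (geq 0%N) l = all (spart_rel 0) l.
    by apply: eq_all => y; rewrite /spart_rel /=; lia.
  by rewrite andbA.
have -> : all (spart_rel x) l = all (geq x) l && (x \notin l).
  elim: l {IH} => //= y l ->; rewrite inE negb_or /spart_rel (negbTE x0) orbF.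
  by rewrite ltn_neqAle eq_sym -!andbA; do !bool_congr.
by rewrite mem_filter x0 /= -!andbA; congr (_ && _); rewrite andbCA.
Qed.

Lemma strict_nth_inj lam i j : strict_partition lam ->
  (i < size lam)%N -> (j < size lam)%N ->
  nth 0%N lam i = nth 0%N lam j -> nth 0%N lam i != 0%N -> i = j.
Proof.
rewrite strict_partitionE => sl il jl E n0.
have H a b : (a < b)%N -> (b < size lam)%N -> spart_rel (nth 0%N lam a) (nth 0%N lam b).
  move=> ab bl; apply: (sorted_ltn_nth spart_rel_trans) => //; rewrite inE //.
  exact: ltn_trans bl.
by case: (ltngtP i j) => // ij; have := H _ _ ij; rewrite ?il ?jl => /(_ isT);
  rewrite /spart_rel ?E; move: n0; rewrite ?E; lia.
Qed.

Notation vacn l := (vac (map Posz l)).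

Lemma QpartE lam : Qpart lam = vacn lam. Proof. exact: QE. Qed.

(** The coefficient of [x^k] in [kappa_(-1/x)(A) F(A, x)]. *)
Definition Dvertex (k : nat) (F : symser) : symser := (-1) ^+ k * phi (- k%:Z) F.

Lemma Dvertex_vacn k lam : (0 < k)%N -> Dvertex k (vacn lam) =
  \sum_(j < size lam) if nth 0%N lam j == k
    then (-1) ^+ j * (2%:R * vacn (del_nth j lam)) else 0.
Proof.
case: k => // k _; rewrite /Dvertex phi_word; last exact: Gamma1.
rewrite phi_neg1 word0 mulr0 addr0 size_map mulr_sumr; apply: eq_bigr => j _.
rewrite (nth_map 0%N) // addrC subr_eq0 eqz_nat map_del.
case: eqP => _; last by rewrite mulr0.
rewrite abszN absz_nat mulrnAr mulrCA (mulrA ((-1) ^+ k.+1)) -expr2 sqrr_sign mul1r.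
by rewrite mulr_natl mulrnAr.
Qed.

(** [phi (- k)] anticommutes with every letter other than [k], and kills 1. *)
Lemma is_D_vertex k : (0 < k)%N -> is_D k (Dvertex k).
Proof.
move=> k0; split=> [c F G _ _|lam i sl il ik|lam sl kl].
- by rewrite /Dvertex phi_lin mulrDr -scalerAr.
- rewrite !QpartE Dvertex_vacn // (bigD1 (Ordinal il)) //= ik eqxx big1 ?addr0 //.
  move=> j /eqP ji; case: eqP => // jk; case: ji; apply: val_inj => /=.
  by apply: (strict_nth_inj sl) => //; rewrite jk // -lt0n.
- rewrite QpartE Dvertex_vacn // big1 // => j _; case: eqP => // jk.
  by case/negP: kl; rewrite -jk mem_nth.
Qed.

Inductive Qspan : symser -> Prop :=
| Qspan0 : Qspan 0
| Qspan_cons c lam F :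
    strict_partition lam -> Qspan F -> Qspan (c *: Qpart lam + F).

Lemma QspanD F G : Qspan F -> Qspan G -> Qspan (F + G).
Proof.
move=> QF QG; elim: QF => [|c lam F' sl _ IH]; first by rewrite add0r.
by rewrite -addrA; apply: Qspan_cons.
Qed.

Lemma QspanZ c F : Qspan F -> Qspan (c *: F).
Proof.
elim=> [|d lam F' sl _ IH]; first by rewrite scaler0; apply: Qspan0.
by rewrite scalerDr scalerA; apply: Qspan_cons.
Qed.

Lemma Qspan_sum I (r : seq I) (P : pred I) (F : I -> symser) :
  (forall i, P i -> Qspan (F i)) -> Qspan (\sum_(i <- r | P i) F i).
Proof. by move=> QF; elim/big_ind: _ => //; [apply: Qspan0|apply: QspanD]. Qed.

Lemma QspanN F : Qspan F -> Qspan (- F).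
Proof. by rewrite -scaleN1r; apply: QspanZ. Qed.

Lemma QspanMn F k : Qspan F -> Qspan (F *+ k).
Proof. by rewrite -scaler_nat; apply: QspanZ. Qed.

Lemma Qspan_sign F k : Qspan F -> Qspan ((-1) ^+ k * F).
Proof.
by move=> QF; rewrite -signr_odd; case: odd; rewrite ?mul1r // mulN1r; apply: QspanN.
Qed.

(** Insertion of a part: a new letter is moved to its place by
    anticommutation, and a repeated nonzero letter gives zero. *)
Lemma phi_vacn_sort (r : nat) lam : strict_partition lam ->
  exists (c : rat) (mu : seq nat), [/\ strict_partition mu,
    {subset mu <= r :: lam} & phi r (vacn lam) = c *: vacn mu].
Proof.
elim: lam => [|s l IH]; first by exists 1, [:: r]; rewrite strict_partitionE scale1r; split.
rewrite strict_partitionE => sl.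
have [rs|] := boolP (spart_rel r s).
  by exists 1, [:: r, s & l]; rewrite strict_partitionE scale1r /= rs; split.
rewrite /spart_rel negb_or -leqNgt negb_and => /andP[rs n0].
have anti := phi_anticomm r s (vac_Gamma (map Posz l)).
have [E|ns] := eqVneq r s.
  exists 0, [::]; split=> //; rewrite scale0r; move: anti; rewrite E -mulr2n.
  rewrite gt_eqF => [|]; last by move: n0; rewrite E; lia.
  by move=> H; apply: mulr2n_inj; rewrite mul0rn; exact: H.
move: sl; rewrite /= (path_sortedE spart_rel_trans) => /andP[/allP sl1 sl2].
have [c [mu [smu lmu E]]] := IH (etrans (strict_partitionE l) sl2).
exists (- c), (s :: mu); split.
- move: smu; rewrite !strict_partitionE /= (path_sortedE spart_rel_trans) => ->.
  rewrite andbT; apply/allP => y /lmu; rewrite inE => /orP[/eqP->|/sl1 //].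
  by rewrite /spart_rel; lia.
- move=> y; rewrite !inE => /orP[->|/lmu]; first by rewrite orbT.
  by rewrite inE => /orP[->|->] //; rewrite !orbT.
rewrite scaleNr /= -phiZ -E; apply/eqP; rewrite -addr_eq0 anti gt_eqF //.
by lia.
Qed.

Lemma Qspan_vacn_strict lam : strict_partition lam -> Qspan (vacn lam).
Proof.
move=> sl; rewrite -QpartE -[Qpart lam]scale1r -[_ *: _]addr0.
by apply: Qspan_cons => //; apply: Qspan0.
Qed.

Lemma Qspan_phi (r : nat) F : Qspan F -> Qspan (phi r F).
Proof.
elim=> [|c lam G sl _ IH]; first by rewrite phi0; apply: Qspan0.
rewrite phi_lin; apply: QspanD => //; apply: QspanZ.
have [d [mu [smu _ E]]] := phi_vacn_sort r sl.
by rewrite QpartE E; apply: QspanZ; apply: Qspan_vacn_strict.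
Qed.

Lemma Qspan_vacn w : Qspan (vacn w).
Proof. by elim: w => [|r w IH]; [apply: Qspan_vacn_strict | apply: Qspan_phi]. Qed.

(** Solving the relation between [phi r] and the multiplication by [q n] for
    [q n * phi r F] leaves shorter words, or words multiplied by some [q m]
    with [m < n]. *)
Lemma Qspan_q_vacn w (n : nat) : Qspan (q n * vacn w).
Proof.
elim: w n => [|r w IHw] n.
  by rewrite mulr1 -phi1; apply: Qspan_phi; apply: (Qspan_vacn [::]).
elim/ltn_ind: n r => n IHn r /=.
have nB : n%:Z < n.+1%:Z by lia.
have /eqP := phi_qM r (vacn w) nB.
rewrite big_ord_recl /= expr0 mul1r mulr1n addr0 subr0 -subr_eq => /eqP <-.
apply: QspanD; first by apply: Qspan_phi; apply: IHw.
apply: QspanN; apply: Qspan_sum => a _; apply: QspanMn; apply: Qspan_sign.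
rewrite /bump /= add1n subzn //.
by apply: (IHn _ _ (r + a.+1)%N); have := ltn_ord a; lia.
Qed.

Lemma Gamma_Qspan F : Gamma F -> Qspan F.
Proof.
move=> GF; elim/Gamma_qind: F / GF => [|n F _ QF|c F G _ _ QF QG].
- exact: (Qspan_vacn [::]).
- elim: QF => [|c lam G sl _ IH]; first by rewrite mulr0; apply: Qspan0.
  rewrite mulrDr -scalerAr; apply: QspanD => //; apply: QspanZ.
  by rewrite QpartE; apply: Qspan_q_vacn.
- by apply: QspanD => //; apply: QspanZ.
Qed.

Lemma Gamma_Qpart lam : Gamma (Qpart lam).
Proof. by rewrite QpartE; apply: vac_Gamma. Qed.

(** The conditions defining [D k] determine it on the span of the Q_lam,
    which is all of [Gamma]. *)
Lemma D_vertex k F : (0 < k)%N -> Gamma F -> D k F = Dvertex k F.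
Proof.
move=> k0 GF.
have [Dlin Din Dout] : is_D k (D k).
  by apply: (xgetPex _ (P := [set E | is_D k E]%classic)); exists (Dvertex k); apply: is_D_vertex.
have [Elin Ein Eout] := is_D_vertex k0.
have lin0 (E : symser -> symser) : (forall (c : rat) (F G : symser), Gamma F ->
    Gamma G -> E (c *: F + G) = c *: E F + E G) -> E 0 = 0.
  move=> lin; have := lin (-1) 0 0 Gamma0 Gamma0.
  by rewrite scaler0 addr0 scaleN1r addNr.
have key G : Qspan G -> Gamma G /\ D k G = Dvertex k G.
  elim=> [|c lam G' sl _ [GG' IH]].
    by split; [apply: Gamma0 | rewrite !lin0].
  split; first by apply: Gamma_lin => //; apply: Gamma_Qpart.
  rewrite Dlin ?Elin ?IH //; try exact: Gamma_Qpart.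
  congr (_ *: _ + _).
  have [kl|kl] := boolP (k \in lam); last by rewrite Dout ?Eout.
  have il : (index k lam < size lam)%N by rewrite index_mem.
  by rewrite (Din _ _ sl il (nth_index _ kl)) (Ein _ _ sl il (nth_index _ kl)).
by have [] := key F (Gamma_Qspan GF).
Qed.

(** * Newton's recursion *)

Definition torsion_free (R : nmodType) :=
  forall (x : R) n, x *+ n.+1 = 0 -> x = 0.

Lemma torsion_free_lmod (V : lmodType rat) : torsion_free V.
Proof.
move=> x n /(congr1 (fun z => n.+1%:R^-1 *: z)).
by rewrite -scaler_nat scalerA mulVf ?Num.Theory.pnatr_eq0 // scale1r scaler0.
Qed.

Lemma torsion_free_poly (R : nzRingType) : torsion_free R -> torsion_free {poly R}.
Proof.
move=> tR p n p0; apply/polyP => i; rewrite coef0; apply: (tR _ n).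
by rewrite -coefMn p0 coef0.
Qed.

Section Newton.
Variable R : comNzRingType.
Implicit Types (p : nat -> R) (f g : fps R).

Definition odd_ser p : fps R := Fps (fun r => p r *+ (odd r).*2).

(** [f] is the exponential of the sum of the [2 p_r z^r / r], [r] odd: for the
    power sums [p], this is the series [kappa_z]. *)
Definition newton p f := cf f 0 = 1 /\ theta f = odd_ser p * f.

Lemma newton_uniq p f g : torsion_free R -> newton p f -> newton p g -> f = g.
Proof.
move=> tR [f0 fN] [g0 gN]; apply/fpsP; elim/ltn_ind => -[|n] IH.
  by rewrite f0 g0.
apply/eqP; rewrite -subr_eq0; apply/eqP; apply: (tR _ n).
move/fpsP/(_ n.+1): fN; move/fpsP/(_ n.+1): gN; rewrite !cfM /= => gN fN.
rewrite mulrnBl fN gN -sumrB big1 // => i _.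
case: (posnP i) => [->|i0]; first by rewrite mulr0n !mul0r subrr.
by rewrite IH ?subrr //; have := ltn_ord i; lia.
Qed.

Lemma newton_ext p p' f : (forall r, odd r -> p r = p' r) ->
  newton p f -> newton p' f.
Proof.
move=> pp' [f0 fN]; split=> //; rewrite fN; congr (_ * _); apply/fpsP => r /=.
by case: (boolP (odd r)) => // /pp' ->.
Qed.

Lemma newton1 : newton (fun=> 0) 1.
Proof.
split=> //; rewrite (_ : odd_ser _ = 0) ?mul0r.
  by apply/fpsP => -[|n]; rewrite /= ?mulr0n ?mul0rn.
by apply/fpsP => n /=; rewrite mul0rn.
Qed.

Lemma newtonM p p' f g : newton p f -> newton p' g ->
  newton (fun r => p r + p' r) (f * g).
Proof.
move=> [f0 fN] [g0 gN]; split; first by rewrite cfM big_ord1 f0 g0 mulr1.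
have -> : odd_ser (fun r => p r + p' r) = odd_ser p + odd_ser p'.
  by apply/fpsP => r; rewrite cfD /= mulrnDl.
rewrite thetaM fN gN; ring.
Qed.

Lemma newton_prod I (s : seq I) (p : I -> nat -> R) (F : I -> fps R) :
  (forall i, newton (p i) (F i)) ->
  newton (fun r => \sum_(i <- s) p i r) (\prod_(i <- s) F i).
Proof.
move=> pF; elim: s => [|i s IH].
  rewrite big_nil; apply: newton_ext newton1 => r _; by rewrite big_nil.
rewrite big_cons; apply: newton_ext (newtonM (pF i) IH) => r _.
by rewrite big_cons.
Qed.

Lemma newton_zscale y p f : newton p f ->
  newton (fun r => y ^+ r * p r) (zscale y f).
Proof.
move=> [f0 fN]; split; first by rewrite /= mul1r f0.
have -> : theta (zscale y f) = zscale y (theta f).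
  by apply/fpsP => n /=; rewrite mulrnAr.
rewrite fN zscaleM; congr (_ * _).
by apply/fpsP => n /=; rewrite mulrnAr.
Qed.

(** [kappa_z kappa_(-z) = 1]. *)
Lemma newton_inv p f : torsion_free R -> newton p f -> zscale (-1) f * f = 1.
Proof.
move=> tR fN; apply: (newton_uniq tR _ newton1).
apply: newton_ext (newtonM (newton_zscale (-1) fN) fN) => r ro.
by rewrite -signr_odd ro expr1 mulN1r addNr.
Qed.

End Newton.

Lemma newton_fmap (R S : comNzRingType) (h : {rmorphism R -> S}) p f :
  newton p f -> newton (fun r => h (p r)) (fmap_fps h f).
Proof.
move=> [f0 fN]; split; first by rewrite /= f0 rmorph1.
have -> : theta (fmap_fps h f) = fmap_fps h (theta f).
  by apply/fpsP => n /=; rewrite rmorphMn.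
rewrite fN fmapM; congr (_ * _).
by apply/fpsP => n /=; rewrite rmorphMn.
Qed.

Section KappaPower.
Variable A : comAlgType rat.
Implicit Types (c : rat) (x : A) (f g : fps A).

(** The logarithmic derivatives [c zx / (1 + zx)] and [c zx / (1 - zx)] add up
    to the sum of the [2 c x^r z^r] over odd [r]. *)
Lemma newton_ratio c x f g : cf f 0 = 1 -> cf g 0 = 1 ->
    (1 + fpsX x) * theta f = fpsX (c *: x) * f ->
    (1 - fpsX x) * theta g = fpsX (c *: x) * g ->
  newton (fun r => c *: x ^+ r) (f * g).
Proof.
move=> f0 g0 fN gN; split; first by rewrite cfM big_ord1 f0 g0 mulr1.
have gx : (1 + fpsX x) * geom (- x) = 1.
  by rewrite -[RHS](geomE (- x)) fpsXN opprK.
pose D := (1 - fpsX x) * (1 + fpsX x).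
have DV : D * (geom x * geom (- x)) = 1 by rewrite /D mulrACA geomE gx mulr1.
suff key : D * theta (f * g) = D * (odd_ser (fun r => c *: x ^+ r) * (f * g)).
  by rewrite -[LHS]mul1r -[RHS]mul1r -DV [D * _]mulrC -!(mulrA _ D) key.
have oddE : D * odd_ser (fun r => c *: x ^+ r) = fpsX (c *: x) *+ 2.
  pose C : fps A := Fps (fun n => c%:A *+ (n == 0%N)).
  have CM h n : cf (C * h) n = c *: cf h n.
    rewrite cfM big_ord_recl big1 ?addr0 => [|i _] /=; last by rewrite mulr0n mul0r.
    by rewrite mulr1n subn0 mulr_algl.
  have -> : odd_ser (fun r => c *: x ^+ r) = C * (geom x - geom (- x)).
    apply/fpsP => n; rewrite CM cfD cfN /= exprNn -signr_odd.
    by case: odd; rewrite ?expr1 ?mulN1r ?opprK ?mul1r ?subrr ?mulr0n ?scaler0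
      // -mulr2n scalerMnr.
  have -> : fpsX (c *: x) = C * fpsX x.
    by apply/fpsP => n; rewrite CM /= scalerMnr.
  have DG : D * (geom x - geom (- x)) = fpsX x *+ 2.
    transitivity ((1 + fpsX x) * ((1 - fpsX x) * geom x)
                  - (1 - fpsX x) * ((1 + fpsX x) * geom (- x))).
      by rewrite /D; ring.
    by rewrite geomE gx; ring.
  by rewrite mulrCA DG mulrnAr.
rewrite thetaM mulrDr (mulrA D (odd_ser _)) oddE.
have -> : D * (theta f * g) = (1 - fpsX x) * (fpsX (c *: x) * f) * g.
  by rewrite -fN /D !mulrA.
have -> : D * (f * theta g) = (1 + fpsX x) * f * (fpsX (c *: x) * g).
  by rewrite -gN /D; ring.
by rewrite mulr2n; ring.
Qed.

Definition kappa_ser c x : fps A :=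
  Fps (fun j => gbin c j *: x ^+ j) *
  Fps (fun j => (gbin (- c) j * (-1) ^+ j) *: x ^+ j).

Lemma kappa_powE d c x j : (j <= d)%N -> (kappa_pow d c x)`_j = cf (kappa_ser c x) j.
Proof.
move=> jd; rewrite coefM cfM; apply: eq_bigr => i _.
by rewrite !coef_poly !ifT //; have := ltn_ord i; lia.
Qed.

Lemma gbin0 c : gbin c 0 = 1.
Proof. by rewrite /gbin big_ord0 fact0 mul1r invr1. Qed.

Lemma gbinS c j : gbin c j.+1 *+ j.+1 = gbin c j * (c - j%:R).
Proof.
rewrite /gbin big_ord_recr /= factS natrM -[LHS]mulr_natr.
by rewrite invfM !mulrA [LHS]mulrAC mulfVK ?Num.Theory.pnatr_eq0 // mulrAC.
Qed.

Lemma newton_kappa_ser c x : newton (fun r => c *: x ^+ r) (kappa_ser c x).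
Proof.
apply: newton_ratio; rewrite /= ?gbin0 ?mul1r ?scale1r ?expr0 //.
  apply/fpsP => -[|n]; rewrite mulrDl mul1r cfD !cfXM /= ?mulr0n ?addr0 //.
  rewrite scalerMnl gbinS mulrnAr -scalerAr -exprS -scalerAl -scalerAr -exprS.
  by rewrite !scalerA scalerMnl -scalerDl; congr (_ *: _); rewrite -mulr_natr; ring.
apply/fpsP => -[|n]; rewrite mulrBl mul1r cfD cfN !cfXM /= ?mulr0n ?subr0 //.
rewrite scalerMnl -mulrnAl gbinS mulrnAr -scalerAr -exprS -scalerAl -scalerAr -exprS.
rewrite !scalerA scalerMnl -scalerBl; congr (_ *: _); rewrite -mulr_natr exprS; ring.
Qed.

(** The case [c = 1] of the previous computation. *)
Lemma newton_kap1 x : newton (fun r => x ^+ r) (kap1 x).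
Proof.
rewrite kap1E; apply: newton_ext (newton_ratio (c := 1) (x := x) _ _ _ _).
- by move=> r _; rewrite scale1r.
- by rewrite cfD cf1 /= addr0.
- by rewrite /= expr0.
- rewrite scale1r [RHS]mulrC; congr (_ * _); apply/fpsP => -[|[|n]] /=;
    by rewrite ?mulr0n ?mulr1n ?add0r ?addr0 ?mul0rn.
- rewrite scale1r; apply/fpsP => -[|n]; rewrite mulrBl mul1r cfD cfN !cfXM /= ?mulr0n ?subr0 //.
  by rewrite mulrnAr -exprS -mulrnBr // subSnn mulr1n.
Qed.

End KappaPower.

(** * Plethysm *)

(** The Adams operation, raising every variable to the power [r]. *)
Definition adams N (r : nat) (P : {mpoly rat[N]}) : {mpoly rat[N]} :=
  P \mPo [tuple 'X_i ^+ r | i < N].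

Section Adams.
Variables (N r : nat).

Fact adams_additive : zmod_morphism (@adams N r).
Proof. by move=> P P'; rewrite /adams raddfB. Qed.
Fact adams_mult : monoid_morphism (@adams N r).
Proof. by split=> [|P P']; rewrite /adams ?rmorph1 ?rmorphM. Qed.
HB.instance Definition _ :=
  GRing.isZmodMorphism.Build _ _ (@adams N r) adams_additive.
HB.instance Definition _ :=
  GRing.isMonoidMorphism.Build _ _ (@adams N r) adams_mult.

Lemma adamsX i : @adams N r 'X_i = 'X_i ^+ r.
Proof. by rewrite /adams comp_mpolyXU -tnth_nth tnth_mktuple. Qed.

Lemma adamsE (P : {mpoly rat[N]}) :
  adams r P = \sum_(mu <- msupp P) P@_mu *: 'X_[mu] ^+ r.
Proof.
rewrite /adams comp_mpolyEX; apply: eq_bigr => mu _; congr (_ *: _).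
rewrite comp_mpolyX mpolyXE_id -prodrXl; apply: eq_bigr => i _.
by rewrite tnth_mktuple exprAC.
Qed.

End Adams.

(** [kappa_z(P)]. *)
Definition qpl_ser N (P : {mpoly rat[N]}) : fps {mpoly rat[N]} :=
  \prod_(mu <- msupp P) kappa_ser P@_mu 'X_[mu].

Lemma qplE n P N : qpl (Posz n) P N = cf (qpl_ser (P N)) n.
Proof.
apply: (@cf_prod_poly _ _ _ _ _ n) => // mu j; exact: kappa_powE.
Qed.

Lemma newton_qpl N (P : {mpoly rat[N]}) : newton (fun r => adams r P) (qpl_ser P).
Proof.
apply: newton_ext (newton_prod _ _) => [r _|mu].
  by symmetry; exact: adamsE.
exact: newton_kappa_ser.
Qed.

Lemma newton_kappaN N : newton (fun r => \sum_(i < N) 'X_i ^+ r) (kappaN N).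
Proof. by apply: newton_prod => i; apply: newton_kap1. Qed.

(** The recursion expresses [n Q_n] through the [p_r], [r] odd, and the [Q_i]
    with [i < n]. *)
Lemma Gamma_newton (p Qs : nat -> symser) :
    (forall N, newton (fun r => p r N) (Fps (fun n => Qs n N))) ->
    (forall r, odd r -> Gamma (p r)) ->
  forall n, Gamma (Qs n).
Proof.
move=> pQ Gp; elim/ltn_ind => -[|n] IH.
  suff -> : Qs 0%N = 1 by apply: Gamma1.
  by apply: symserP => N; have [] := pQ N.
have -> : Qs n.+1 = n.+1%:R^-1 *: (Qs n.+1 *+ n.+1).
  by rewrite -[Qs _ *+ _]scaler_nat scalerA mulVf ?scale1r ?Num.Theory.pnatr_eq0.
apply: Gamma_scale.
have -> : Qs n.+1 *+ n.+1 =
    \sum_(i < n.+2) (p i *+ (odd i).*2) * Qs (n.+1 - i)%N.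
  apply: symserP => N; rewrite ev_sum evMn.
  have [_ /fpsP/(_ n.+1)] := pQ N; rewrite cfM /= => ->.
  by apply: eq_bigr => i _; rewrite evM evMn.
apply: Gamma_sum => i _; case: (boolP (odd i)) => [oi|_]; last first.
  by rewrite mulr0n mul0r; apply: Gamma0.
apply: Gamma_mul; first by apply: Gamma_natmul; apply: Gp.
by apply: IH; case: i oi => [[|i] hi] //= _; lia.
Qed.

Definition psum (r : nat) : symser := fun N => \sum_(i < N) 'X_i ^+ r.

(** The recursion for the [q_n], solved for its last term [2 p_r]. *)
Lemma Gamma_psum r : odd r -> Gamma (psum r).
Proof.
elim/ltn_ind: r => r IH ro.
have -> : psum r = 2%:R^-1 *: (q r *+ r -
    \sum_(i < r) (psum i *+ (odd i).*2) * q (r - i)%N).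
  apply: symserP => N.
  have [c0 /fpsP/(_ r)] := newton_kappaN N; rewrite cfM big_ord_recr /= subnn c0 mulr1.
  rewrite evZ evD evN ev_sum evMn qE => ->.
  rewrite (eq_bigr (fun i : 'I_r => (psum i *+ (odd i).*2 * q (r - i)%N) N)).
    rewrite addrAC subrr add0r ro /= -scaler_nat scalerA.
    by rewrite mulVf ?scale1r.
  by move=> i _; rewrite evM evMn qE.
apply: Gamma_scale; apply: Gamma_add; first by apply: Gamma_natmul; apply: Gamma_qz.
apply: Gamma_opp; apply: Gamma_sum => i _.
case: (boolP (odd i)) => [oi|_]; last by rewrite mulr0n mul0r; apply: Gamma0.
by apply: Gamma_mul; [apply: Gamma_natmul; apply: IH | apply: Gamma_qz].
Qed.

Definition adams_ser r (F : symser) : symser := fun N => adams r (F N).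

Lemma adams_kappaN r N : fmap_fps (@adams N r) (kappaN N) = \prod_(i < N) kap1 ('X_i ^+ r).
Proof.
transitivity (\prod_(i < N) kap1 (adams r 'X_i : {mpoly rat[N]})).
  exact: fmap_prod_kap1.
by apply: eq_bigr => i _; rewrite adamsX.
Qed.

(** Raising the variables to the power [r] turns [p_s] into [p_(rs)], which is
    odd-indexed again. *)
Lemma Gamma_adams_q r n : odd r -> Gamma (adams_ser r (q (Posz n))).
Proof.
move=> ro; apply: (@Gamma_newton (fun s => psum (r * s)%N)
  (fun n => adams_ser r (q n))) => [N|s so]; last first.
  by apply: Gamma_psum; rewrite oddM ro.
have -> : Fps (fun n => adams_ser r (q n) N) = fmap_fps (@adams N r) (kappaN N).
  by apply/fpsP => j; rewrite /= /adams_ser qE.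
rewrite adams_kappaN; apply: newton_ext (newton_prod _ _) => [s _|i].
  reflexivity.
by apply: newton_ext (newton_kap1 _) => s _; rewrite exprM.
Qed.

Lemma Gamma_qpl_q n m : Gamma (qpl (Posz n) (q (Posz m))).
Proof.
apply: (@Gamma_newton (fun r => adams_ser r (q m)) (fun n => qpl n (q m))).
  move=> N; have -> : Fps (fun n => qpl n (q m) N) = qpl_ser (q m N).
    by apply/fpsP => j; rewrite -qplE.
  exact: newton_qpl.
by move=> r ro; apply: Gamma_adams_q.
Qed.

Lemma addvar_adams_q r m N : addvar (adams r (q (Posz m) N.+1)) =
  \sum_(a < m.+1) (adams r (q (m - a)%N N))%:P * ('X^r ^+ a *+ (a != 0%N :> nat).+1).
Proof.
have E : fmap_fps (@addvar N) (fmap_fps (@adams N.+1 r) (kappaN N.+1)) =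
    fmap_fps (@polyC _) (fmap_fps (@adams N r) (kappaN N)) * kap1 'X^r.
  rewrite !adams_kappaN.
  transitivity (\prod_(i < N.+1) kap1 (addvar ('X_i ^+ r))).
    exact: fmap_prod_kap1.
  rewrite big_ord_recr /=; congr (_ * kap1 _); last first.
    by rewrite rmorphXn /= addvar_last.
  transitivity (\prod_(i < N) kap1 (('X_i ^+ r)%:P : {poly {mpoly rat[N]}})).
    by apply: eq_bigr => i _; rewrite rmorphXn /= addvar_widen rmorphXn.
  by symmetry; exact: fmap_prod_kap1.
have /fpsP/(_ m) := E; rewrite mulrC cfM /= -qE => ->.
by apply: eq_bigr => a _; rewrite -qE mulrC.
Qed.

(** * The identity *)

(** The index sets of [I] and of [J] are joined into one. *)
Definition slot m (u : 'I_m + 'I_m) : 'I_m :=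
  match u with inl s => s | inr s => s end.

Definition int_pair m n (I : {ffun 'I_m + 'I_m -> 'I_n.+1}) :
    {ffun 'I_m -> int} * {ffun 'I_m -> int} :=
  ([ffun s => Posz (I (inl s))], [ffun s => Posz (I (inr s))]).

Lemma int_pair_inj m n : injective (@int_pair m n).
Proof.
move=> I I' [/ffunP E1 /ffunP E2]; apply/ffunP => -[s|s]; apply: val_inj.
  by move: (E1 s); rewrite !ffunE => -[].
by move: (E2 s); rewrite !ffunE => -[].
Qed.

(** Only nonnegative [I] and [J] contribute; their entries are then at most
    [n], so that the sum is finite. *)
Lemma fsum_int_pair (V : zmodType) m (n : nat)
    (F : {ffun 'I_m -> int} * {ffun 'I_m -> int} -> V) :
    (forall (IJ : {ffun 'I_m -> int} * {ffun 'I_m -> int}) s,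
       (IJ.1 s < 0) || (IJ.2 s < 0) -> F IJ = 0) ->
  \sum_(IJ \in [set IJ : {ffun 'I_m -> int} * {ffun 'I_m -> int}
     | \sum_(s < m) IJ.1 s + \sum_(s < m) IJ.2 s = n%:Z]%classic) F IJ =
  \sum_(I : {ffun 'I_m + 'I_m -> 'I_n.+1} | (\sum_u I u == n)%N) F (int_pair I).
Proof.
move=> Fneg; set A := [set _ | _]%classic.
have sumE (I : {ffun 'I_m + 'I_m -> 'I_n.+1}) :
    \sum_(s < m) (int_pair I).1 s + \sum_(s < m) (int_pair I).2 s =
    (\sum_u I u)%N%:Z.
  rewrite big_sumType PoszD; congr (_ + _); rewrite (big_morph _ PoszD (erefl _));
    by apply: eq_bigr => s _; rewrite ffunE.
pose r := [seq int_pair J | J : {ffun 'I_m + 'I_m -> 'I_n.+1} <-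
  enum {ffun 'I_m + 'I_m -> 'I_n.+1} & (\sum_u J u == n)%N].
have rA IJ : IJ \in r -> A IJ.
  by case/mapP => I; rewrite mem_filter => /andP[/eqP In _] ->; rewrite /A /= sumE In.
rewrite (fsbigE r) //.
- transitivity (\sum_(IJ <- r) F IJ).
    rewrite [LHS]big_seq_cond [RHS]big_seq; apply: eq_bigl => IJ.
    by case: (boolP (IJ \in r)) => //= /rA /mem_set.
  by rewrite /r big_map big_filter big_enum_cond; apply: eq_bigl => I.
- rewrite map_inj_uniq; last exact: int_pair_inj.
  by apply: filter_uniq; apply: enum_uniq.
move=> IJ AIJ; apply: contraNeq => F0.
have nneg s : (0 <= IJ.1 s) && (0 <= IJ.2 s).
  by apply: contraNT F0; rewrite negb_and -!ltNge => /Fneg ->.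
have nneg1 s : 0 <= IJ.1 s by case/andP: (nneg s).
have nneg2 s : 0 <= IJ.2 s by case/andP: (nneg s).
have le1 s : IJ.1 s <= n%:Z.
  rewrite -AIJ (bigD1 s) //= -addrA Num.Theory.lerDl.
  by rewrite Num.Theory.addr_ge0 // Num.Theory.sumr_ge0.
have le2 s : IJ.2 s <= n%:Z.
  rewrite -AIJ [X in _ + X](bigD1 s) //= addrCA Num.Theory.lerDl.
  by rewrite Num.Theory.addr_ge0 // Num.Theory.sumr_ge0.
pose I := [ffun u : 'I_m + 'I_m =>
  inord (absz (match u with inl s => IJ.1 s | inr s => IJ.2 s end)) : 'I_n.+1].
have IE : int_pair I = IJ.
  rewrite [RHS]surjective_pairing; congr (_, _); apply/ffunP => s; rewrite !ffunE.
    by have := nneg1 s; have := le1 s; case: (IJ.1 s) => //= j jn _; rewrite inordK.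
  by have := nneg2 s; have := le2 s; case: (IJ.2 s) => //= j jn _; rewrite inordK.
apply/mapP; exists I => //; rewrite mem_filter mem_enum andbT.
by have := sumE I; rewrite IE (AIJ : _ = _) => -[/esym/eqP].
Qed.

Lemma vfun1 (R : comNzRingType) (c : int -> R) r : vfun c r 1 = c r.
Proof. by rewrite (@vfunE _ _ 1) ?size_poly1 // big_ord1 coef1 addr0 mulr1 mul1r. Qed.

Lemma vfunXn (R : comNzRingType) (c : int -> R) r w :
  vfun c r 'X^w = (-1) ^+ w * c (r + w%:Z).
Proof. by rewrite -['X^w]mulr1 vfunXM vfun1. Qed.

Lemma vfunC (R : comNzRingType) (c : int -> R) r a p :
  vfun c r (a%:P * p) = a * vfun c r p.
Proof. by rewrite mul_polyC vfunZ. Qed.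

Lemma Dvertex_ev k F N :
  Dvertex k F N = (-1) ^+ k * vfun (fun i => q i N) (- k%:Z) (addvar (F N.+1)).
Proof. by rewrite /Dvertex ev_sign phi_ev. Qed.

Section Generating.
Variables (N m : nat).
Notation R := {mpoly rat[N]}.

Definition qplX_ser (j : nat) : fps {poly R} := 
  fmap_fps (@polyC R) (qpl_ser (q (Posz j) N)).

Lemma newton_qplX_ser j : newton (fun r => (adams r (q (Posz j) N))%:P) (qplX_ser j).
Proof. exact: (@newton_fmap _ _ (@polyC R) _ _ (newton_qpl _)). Qed.

(** [kappa_(z x^s)(q_(m-s))], where [s] is numbered from 1 in the exponent. *)
Definition factor (s : 'I_m) : fps {poly R} := zscale 'X^(s.+1) (qplX_ser (m - s.+1)).

(** [q_m(A, x) = q_m(A) + 2 x q_(m-1)(A) + ... + 2 x^m q_0(A)], and [kappa_z]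
    turns this sum into a product. *)
Lemma addvar_qpl_ser :
  fmap_fps (@addvar N) (qpl_ser (q (Posz m) N.+1)) =
  qplX_ser m * \prod_(u : 'I_m + 'I_m) factor (slot u).
Proof.
have tf : torsion_free {poly R} by apply: torsion_free_poly; apply: torsion_free_lmod.
have n1 : newton (fun r => addvar (adams r (q (Posz m) N.+1)))
    (fmap_fps (@addvar N) (qpl_ser (q (Posz m) N.+1))).
  by apply: newton_fmap; apply: newton_qpl.
have n2 : forall u : 'I_m + 'I_m, newton _ (factor (slot u)) :=
  fun u => newton_zscale 'X^((slot u).+1) (newton_qplX_ser (m - (slot u).+1)).
have n3 := newtonM (newton_qplX_ser m) (newton_prod (index_enum _) n2).
apply: (newton_uniq tf n1); apply: newton_ext n3 => r _.
rewrite [RHS]addvar_adams_q big_sumType /= big_ord_recl /= mulr1 subn0; congr (_ + _).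
rewrite -big_split; apply: eq_bigr => s _ /=.
by rewrite /bump add1n mulrnAr mulrC exprAC mulr2n.
Qed.

Lemma cf_factor s a :
  cf (factor s) a = (qpl (Posz a) (q (Posz (m - s.+1))) N)%:P * 'X^(s.+1 * a).
Proof. by rewrite exprM mulrC qplE. Qed.

(** Multiplying [addvar_qpl_ser] by [kappa_(-z)(q_m)] cancels its first factor. *)
Lemma gen_identity n :
  \sum_(p < n.+1) ((-1) ^+ p * qpl (Posz p) (q (Posz m)) N)%:P *
     addvar (qpl (Posz (n - p)) (q (Posz m)) N.+1) =
  \sum_(I : {ffun 'I_m + 'I_m -> 'I_n.+1} | (\sum_u I u == n)%N)
     (\prod_u qpl (Posz (I u)) (q (Posz (m - (slot u).+1))) N)%:P *
     'X^(\sum_u (slot u).+1 * I u).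
Proof.
have tf : torsion_free {poly R} by apply: torsion_free_poly; apply: torsion_free_lmod.
have E : zscale (-1) (qplX_ser m) * fmap_fps (@addvar N) (qpl_ser (q (Posz m) N.+1)) =
    \prod_(u : 'I_m + 'I_m) factor (slot u).
  by rewrite addvar_qpl_ser mulrA (newton_inv tf (newton_qplX_ser m)) mul1r.
move/fpsP/(_ n): E; rewrite cfM cf_prod_fin => E.
have c1 p : ((-1) ^+ p * qpl (Posz p) (q (Posz m)) N)%:P =
    cf (zscale (-1) (qplX_ser m)) p.
  by rewrite polyCM rmorphXn rmorphN1 qplE.
have c2 p : addvar (qpl (Posz p) (q (Posz m)) N.+1) =
    cf (fmap_fps (@addvar N) (qpl_ser (q (Posz m) N.+1))) p.
  by rewrite qplE.
transitivity (\sum_(i < n.+1) cf (zscale (-1) (qplX_ser m)) i *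
  cf (fmap_fps (@addvar N) (qpl_ser (q (Posz m) N.+1))) (n - i)).
  by apply: eq_bigr => p _; exact: (congr2 *%R (c1 p) (c2 (n - p)%N)).
rewrite {}E; apply: eq_bigr => I _.
rewrite rmorph_prod -prodrXr -big_split; apply: eq_bigr => u _ /=.
exact: cf_factor.
Qed.

End Generating.

Lemma qpl_neg n P : n < 0 -> qpl n P = 0.
Proof. by case: n. Qed.

(** In the formula for [D_k], the power [x^w] contributes
    [(-1)^(w-k) q_(w-k)]. *)
Lemma alt_sum_D k n m N : (0 < k)%N ->
  (\sum_(0 <= p < n.+1)
     (-1) ^+ p * (qpl p%:Z (q m%:Z) * D k (qpl (n%:Z - p%:Z) (q m%:Z)))) N =
  \sum_(I : {ffun 'I_m + 'I_m -> 'I_n.+1} | (\sum_u I u == n)%N)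
     (-1) ^+ (k + \sum_u (slot u).+1 * I u) *
     (q ((\sum_u (slot u).+1 * I u)%N%:Z - k%:Z) N *
      \prod_u qpl (Posz (I u)) (q (m - (slot u).+1)%N) N).
Proof.
move=> k0; rewrite ev_sum big_mkord.
have aux (S : comNzRingType) (x a y v : S) : x * (a * (y * v)) = y * (x * a * v).
  by ring.
transitivity ((-1) ^+ k * vfun (fun i => q i N) (- k%:Z)
  (\sum_(p < n.+1) ((-1) ^+ p * qpl (Posz p) (q m%:Z) N)%:P *
     addvar (qpl (Posz (n - p)) (q m%:Z) N.+1))).
  rewrite vfun_sum mulr_sumr; apply: eq_bigr => p _.
  rewrite subzn; last by rewrite -ltnS.
  rewrite D_vertex //; last exact: Gamma_qpl_q.
  rewrite ev_sign evM Dvertex_ev vfunC; exact: aux.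
rewrite gen_identity vfun_sum mulr_sumr; apply: eq_bigr => I _.
rewrite vfunC vfunXn exprD -!mulrA; congr (_ * _).
rewrite mulrCA; congr (_ * _); rewrite mulrC; congr (q _ N * _).
by rewrite addrC.
Qed.

Lemma sign_exprz (A : lalgType rat) (w k : nat) (x : A) :
  ((-1) ^ (w%:Z - k%:Z) : rat) *: x = (-1) ^+ (k + w) * x.
Proof.
have -> : (-1) ^ (w%:Z - k%:Z) = (-1) ^+ (k + w) :> rat.
  by rewrite expfzDr // -exprnN invr_sign -exprnP -exprD addnC.
by rewrite -!(signr_odd _ (k + w)); case: odd; rewrite ?scale1r ?mul1r ?scaleN1r ?mulN1r.
Qed.

Theorem theorem4p5 (k n m : nat) (hk : (0 < k)%N) (hn : (0 < n)%N)
    (hm : (0 < m)%N) :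
  \sum_(0 <= p < n.+1)
     (-1) ^+ p * (qpl p%:Z (q m) * D k (qpl (n%:Z - p%:Z) (q m)))
  = \sum_(IJ \in [set IJ : {ffun 'I_m -> int} * {ffun 'I_m -> int}
                 | \sum_(s < m) IJ.1 s + \sum_(s < m) IJ.2 s = n%:Z]%classic)
      (let e : int := \sum_(s < m) (IJ.1 s + IJ.2 s) * (s.+1)%:Z - k%:Z in
       ((-1) ^ e : rat) *:
       (q e * \prod_(s < m) (qpl (IJ.1 s) (q (m%:Z - (s.+1)%:Z)) *
                             qpl (IJ.2 s) (q (m%:Z - (s.+1)%:Z))))).
Proof.
apply: symserP => N; rewrite alt_sum_D // fsum_int_pair => [|IJ s IJs]; last first.
  rewrite /= [X in q _ * X](bigD1 s) //=.
  by case/orP: IJs => /qpl_neg ->; rewrite ?mul0r ?mulr0 ?mul0r ?mulr0 ?scaler0.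
rewrite ev_sum; apply: eq_bigr => I _; cbv zeta.
set w := (\sum_u _)%N.
have -> : \sum_(s < m) ((int_pair I).1 s + (int_pair I).2 s) * s.+1%:Z = w%:Z.
  rewrite /w big_sumType PoszD !(big_morph _ PoszD (erefl _)) -big_split.
  by apply: eq_bigr => s _; rewrite !ffunE mulrC mulrDr !PoszM.
rewrite evZ evM ev_prod sign_exprz; congr (_ * (_ * _)).
rewrite big_sumType; under [RHS]eq_bigr do rewrite evM.
by rewrite [RHS]big_split; congr (_ * _); apply: eq_bigr => s _; rewrite ffunE subzn.
Qed.
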